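(* Let $f,g,h,L,\gamma$ satisfy the assumptions in the context, let $\varphi(x)=f(x)+g(x)+h(Lx)$ on $\mathbb{R}^n$, and let $\varphi^\gamma$ be the envelope defined in the context. Then $z^*\in\mathbb{R}^n$ is a critical point of $\varphi^{\gamma}$ if and only if $P_{\gamma g}(z^* )$ is a stationary point of $\varphi$.
   Context: Notation. For $\xi:\mathbb{R}^n\to\mathbb{R}\cup\{\infty\}$ and $\gamma>0$: $P_{\gamma \xi}(z)=\arg\min_{u\in\mathbb{R}^n}\{\xi(u)+\frac{1}{2\gamma}\|u-z\|^2\}$ is the proximal mapping and $\xi^{\gamma}(z)=\inf_{u\in\mathbb{R}^n}\{\xi(u)+\frac{1}{2\gamma}\|z-u\|^2\}$ is the Moreau envelope. A function is $\beta$-weakly convex if adding $\frac{\beta}{2}\|\cdot\|^2$ makes it convex. ''$M$-Lipschitz differentiable'' means differentiable with $M$-Lipschitz gradient. $\|\cdot\|$ is the Euclidean norm (operator norm for $L$), and $1/0=+\infty$. Critical and stationary points. $x^*$ is a critical point of a function $\psi$ if $\psi$ is differentiable at $x^*$ and $\nabla\psi(x^* )=\mathbf{0}$. $x^*\in\mathrm{dom}\,\psi$ is a stationary point of $\psi$ if $\mathbf{0}\in\partial\psi(x^* )$, where $\partial\psi(x)$ is the (limiting) subdifferential: the set of $v\in\mathbb{R}^n$ for which there exist $x^t\to x$ with $\psi(x^t)\to\psi(x)$ and $v^t\to v$ such that $\liminf_{z\to x^t}\frac{\psi(z)-\psi(x^t)-\langle v^t,z-x^t\rangle}{\|z-x^t\|}\ge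 0$ for each $t$. Assumptions. $L:\mathbb{R}^n\to\mathbb{R}^m$ is linear; $g:\mathbb{R}^n\to\mathbb{R}$ is $L_g$-Lipschitz differentiable; $h:\mathbb{R}^m\to\mathbb{R}$ is $L_h$-Lipschitz differentiable; $f:\mathbb{R}^n\to\mathbb{R}\cup\{\infty\}$ is proper and lower semicontinuous; $\gamma\in(0,\frac{1}{L_g+L_h\|L\|^2})$; and $f+\frac{1}{2\gamma'}\|\cdot\|^2$ is bounded below for every $\gamma'\in(0,\frac{1}{L_g+L_h\|L\|^2})$. Moreover $f$ is $\beta_f$-weakly convex, $\gamma\in(0,\frac{1}{\beta_f})$, and $g,h$ are twice continuously differentiable. Under these assumptions $P_{\gamma g}$ and $P_{\gamma f}$ are single-valued. Envelope. With $q(z)=L^T\nabla h\big(LP_{\gamma g}(z)\big)$, $$\varphi^{\gamma}(z) = g^{\gamma}(z)-\gamma \|\nabla g^{\gamma}(z)\|^2-\gamma \langle q(z), \nabla g^{\gamma}(z)\rangle +h\big(LP_{\gamma g}(z)\big)-\frac{\gamma}{2}\|q(z)\|^2 +f^{\gamma}\big(z-2\gamma \nabla g^{\gamma}(z)-\gamma q(z)\big).$$ *)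

(* Defs.v *)
From mathcomp Require Import all_boot all_order all_algebra.
From mathcomp Require Import all_classical all_reals all_analysis.

Set Implicit Arguments.
Unset Strict Implicit.
Unset Printing Implicit Defensive.

Import Order.TTheory GRing.Theory Num.Theory.
Import numFieldNormedType.Exports.

Local Open Scope classical_set_scope.
Local Open Scope ring_scope.

(* Vectors of R^n are rows, as for the Jacobian ['J].  The library norm on
   ['rV[R]_n] is the sup norm: it is only used through the topology it induces
   and the notions of differentiability and limit, which do not depend on the
   norm; every metric quantity below uses [enorm]. *)
Definition dot (R : realType) (n : nat) (u v : 'rV[R]_n) : R :=
  \sum_(i < n) u 0 i * v 0 i.

Definition enorm (R : realType) (n : nat) (u : 'rV[R]_n) : R :=
  Num.sqrt (dot u u).

Definition opnorm (R : realType) (n m : nat)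
    (L : {linear 'rV[R]_n -> 'rV[R]_m}) : R :=
  sup [set enorm (L u) | u in [set u | enorm u <= 1]].

(* [lin1_mx L] satisfies [L u = u *m lin1_mx L] on rows. *)
Definition adjoint (R : realType) (n m : nat)
    (L : {linear 'rV[R]_n -> 'rV[R]_m}) (v : 'rV[R]_m) : 'rV[R]_n :=
  v *m (lin1_mx L)^T.

(* Meaningful only where [g] is differentiable. *)
Definition grad (R : realType) (n : nat) (g : 'rV[R]_n -> R) (x : 'rV[R]_n) :
    'rV[R]_n :=
  \row_(i < n) ('d (g : 'rV[R]_n -> R^o) x (delta_mx 0 i) : R).

Definition lipschitz_differentiable (R : realType) (n : nat) (M : R)
    (g : 'rV[R]_n -> R) : Prop :=
  (forall x, differentiable (g : 'rV[R]_n -> R^o) x) /\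
  (forall x y, enorm (grad g x - grad g y) <= M * enorm (x - y)).

Definition twice_continuously_differentiable (R : realType) (n : nat)
    (g : 'rV[R]_n -> R) : Prop :=
  [/\ forall x, differentiable (g : 'rV[R]_n -> R^o) x,
      forall x, differentiable (grad g) x &
      continuous (fun x => 'J (grad g) x)].

Local Open Scope ereal_scope.

(* Functions R^n -> R u {oo} are [\bar R]-valued; [eproper] excludes -oo. *)
Definition eproper (R : realType) (n : nat) (xi : 'rV[R]_n -> \bar R) : Prop :=
  (forall x, xi x != -oo) /\ (exists x, xi x < +oo).

Definition edom (R : realType) (n : nat) (xi : 'rV[R]_n -> \bar R) :
    set 'rV[R]_n :=
  [set x | xi x < +oo].

(* [0 * +oo = 0] in [\bar R], so the end points of [0, 1] are harmless. *)
Definition econvex (R : realType) (n : nat) (xi : 'rV[R]_n -> \bar R) : Prop :=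
  forall (x y : 'rV[R]_n) (t : R), (0 <= t <= 1)%R ->
    xi (t *: x + (1 - t) *: y)%R <= t%:E * xi x + (1 - t)%:E * xi y.

Definition weakly_convex (R : realType) (n : nat) (beta : R)
    (xi : 'rV[R]_n -> \bar R) : Prop :=
  econvex (fun x => xi x + (beta / 2 * enorm x ^+ 2)%:E).

Definition ebounded_below (R : realType) (n : nat) (xi : 'rV[R]_n -> \bar R) :
    Prop :=
  exists c : R, forall x, c%:E <= xi x.

Definition prox (R : realType) (n : nat) (gamma : R)
    (xi : 'rV[R]_n -> \bar R) (z : 'rV[R]_n) : set 'rV[R]_n :=
  [set u | forall v,
     xi u + ((2 * gamma)^-1 * enorm (u - z) ^+ 2)%:E <=
     xi v + ((2 * gamma)^-1 * enorm (v - z) ^+ 2)%:E].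

(* The point of [prox gamma xi z] when this set is a singleton. *)
Definition prox_pt (R : realType) (n : nat) (gamma : R)
    (xi : 'rV[R]_n -> \bar R) (z : 'rV[R]_n) : 'rV[R]_n :=
  get (prox gamma xi z).

Definition moreau (R : realType) (n : nat) (gamma : R)
    (xi : 'rV[R]_n -> \bar R) (z : 'rV[R]_n) : \bar R :=
  ereal_inf
    (range (fun u => xi u + ((2 * gamma)^-1 * enorm (z - u) ^+ 2)%:E)).

(* When [psi x = +oo] the convention [+oo - +oo = -oo] makes every quotient
   -oo, so (for n > 0) there is no Frechet subgradient outside the domain. *)
Definition frechet_subgradient (R : realType) (n : nat)
    (psi : 'rV[R]_n -> \bar R) (x v : 'rV[R]_n) : Prop :=
  0 <= limf_einf
         (fun z : 'rV[R]_n =>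
            (psi z - psi x - (dot v (z - x)%R)%:E) / (enorm (z - x))%:E)
         (x^').

Definition subdifferential (R : realType) (n : nat)
    (psi : 'rV[R]_n -> \bar R) (x : 'rV[R]_n) : set 'rV[R]_n :=
  [set v | exists (xs vs : nat -> 'rV[R]_n),
     [/\ xs @ \oo --> x,
         (fun t => psi (xs t)) @ \oo --> psi x,
         vs @ \oo --> v &
         forall t, frechet_subgradient psi (xs t) (vs t)]].

Definition stationary_point (R : realType) (n : nat)
    (psi : 'rV[R]_n -> \bar R) (x : 'rV[R]_n) : Prop :=
  edom psi x /\ subdifferential psi x 0%R.

(* An [\bar R]-valued function is differentiable at [x] when it is finite near
   [x] and its real-valued restriction is differentiable there. *)
Definition critical_point (R : realType) (n : nat)
    (psi : 'rV[R]_n -> \bar R) (x : 'rV[R]_n) : Prop :=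
  [/\ \forall y \near x, psi y \is a fin_num,
      differentiable (fine \o psi : 'rV[R]_n -> R^o) x &
      grad (fine \o psi) x = 0%R].

Definition objective (R : realType) (n m : nat) (f : 'rV[R]_n -> \bar R)
    (g : 'rV[R]_n -> R) (h : 'rV[R]_m -> R)
    (L : {linear 'rV[R]_n -> 'rV[R]_m}) (x : 'rV[R]_n) : \bar R :=
  f x + (g x)%:E + (h (L x))%:E.

Definition envelope (R : realType) (n m : nat) (gamma : R)
    (f : 'rV[R]_n -> \bar R) (g : 'rV[R]_n -> R) (h : 'rV[R]_m -> R)
    (L : {linear 'rV[R]_n -> 'rV[R]_m}) (z : 'rV[R]_n) : \bar R :=
  let x := prox_pt gamma (EFin \o g) z in
  let q := adjoint L (grad h (L x)) in
  let G := grad (fine \o moreau gamma (EFin \o g)) z in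
  moreau gamma (EFin \o g) z - (gamma * enorm G ^+ 2)%:E
    - (gamma * dot q G)%:E + (h (L x))%:E - (gamma / 2 * enorm q ^+ 2)%:E
    + moreau gamma f (z - (2 * gamma) *: G - gamma *: q)%R.

(* Main.v *)
From HB Require Import structures.
Require Import Defs.
From mathcomp Require Import all_boot all_order all_algebra.
From mathcomp Require Import all_classical all_reals all_analysis.
From mathcomp Require Import ring lra.

(** Write s = g + h o L, S = grad s, K = Lg + Lh |L|^2, and
    T x = x + gamma grad g x.  Let x = prox_{gamma g}(z).

    As gamma Lg < 1, the function g is weakly convex enough for its proximal
    mapping to be the inverse of T ([quad_model_prox_pt]), and the gradient of
    its Moreau envelope at z is (z - x) / gamma = grad g x
    ([moreau_quadratic]).  Completing squares, the envelope of the statement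
    at z becomes the forward-backward envelope of f + s at x
    ([envelope_fbe]):
      E x = inf_u f u + s x + <S x, u - x> + |u - x|^2 / (2 gamma).
    Since T and its inverse are Lipschitz, the envelope is first-order flat at
    z exactly when E is first-order flat at x.  It remains to compare three
    conditions on x.

    - Flat implies fixed.  Let p be the minimizer in E x, that is, the proximal
      point of f at x - gamma S x.  Keeping u = p while moving from x towards p
      makes E decrease at a rate at least (1/gamma - K) |p - x|^2 / 2
      ([fbe_decrease]), and flatness forces p = x ([critical_fbe_fixed]).
    - Fixed implies flat.  If p = x, using u = x bounds E from above, and the
      quadratic growth of the strongly convex problem that defines p bounds it
      from below: E stays within C |y - x|^2 of its value at x ([fbe_flat]).
      A quadratic sandwich yields differentiability with zero gradient
      ([quadratic_differentiable]).
    - Fixed is equivalent to stationary.  If x is the proximal point of f at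
      x - gamma S x, then f + s >= (f + s)(x) - C |. - x|^2, so 0 is a Frechet
      subgradient ([prox_stationary]).  Conversely a Frechet subgradient of
      f + s at a point yields, by weak convexity, a global quadratic minorant
      of f there ([frechet_subgradient_weakly_convex]); such minorants pass to
      the limit in the definition of the limiting subdifferential, and the
      limiting one says that x is the proximal point ([stationary_prox]).

    The analytic inputs are the descent lemma with its sharp constant
    ([descent]) and the existence of minimizers of strongly convex lower
    semicontinuous functions ([prox_exists]). *)

Set Implicit Arguments.
Unset Strict Implicit.
Unset Printing Implicit Defensive.

Import Order.TTheory GRing.Theory Num.Theory.
Import numFieldNormedType.Exports.

Local Open Scope classical_set_scope.
Local Open Scope ring_scope.

Ltac row_ring := apply/rowP => ?; rewrite !mxE; ring.

(** * Euclidean geometry of row vectors *)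

Lemma dotC (R : realType) n (u v : 'rV[R]_n) : dot u v = dot v u.
Proof. by apply: eq_bigr => i _; rewrite mulrC. Qed.

Lemma dotDl (R : realType) n (u v w : 'rV[R]_n) :
  dot (u + v) w = dot u w + dot v w.
Proof. by rewrite /dot -big_split; apply: eq_bigr => i _; rewrite mxE mulrDl. Qed.

Lemma dotZl (R : realType) n (a : R) (u w : 'rV[R]_n) :
  dot (a *: u) w = a * dot u w.
Proof. by rewrite /dot mulr_sumr; apply: eq_bigr => i _; rewrite mxE mulrA. Qed.

Lemma dotNl (R : realType) n (u w : 'rV[R]_n) : dot (- u) w = - dot u w.
Proof. by rewrite -scaleN1r dotZl mulN1r. Qed.

Lemma dotDr (R : realType) n (u v w : 'rV[R]_n) :
  dot w (u + v) = dot w u + dot w v.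
Proof. by rewrite !(dotC w) dotDl. Qed.

Lemma dotZr (R : realType) n (a : R) (u w : 'rV[R]_n) :
  dot w (a *: u) = a * dot w u.
Proof. by rewrite !(dotC w) dotZl. Qed.

Lemma dotNr (R : realType) n (u w : 'rV[R]_n) : dot w (- u) = - dot w u.
Proof. by rewrite !(dotC w) dotNl. Qed.

Lemma dot0r (R : realType) n (w : 'rV[R]_n) : dot w 0 = 0.
Proof. by rewrite -(scale0r (0 : 'rV_n)) dotZr mul0r. Qed.

Lemma dotuu_ge0 (R : realType) n (u : 'rV[R]_n) : 0 <= dot u u.
Proof. by apply: sumr_ge0 => i _; rewrite -expr2 sqr_ge0. Qed.

Lemma enorm_sqr (R : realType) n (u : 'rV[R]_n) : enorm u ^+ 2 = dot u u.
Proof. by rewrite /enorm sqr_sqrtr // dotuu_ge0. Qed.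

Lemma enorm_ge0 (R : realType) n (u : 'rV[R]_n) : 0 <= enorm u.
Proof. exact: sqrtr_ge0. Qed.

(** Expands squared norms and inner products of linear combinations; what is
    left is polynomial arithmetic over the pairwise inner products. *)
Definition dotE :=
  (enorm_sqr, dotDl, dotDr, dotNl, dotNr, dotZl, dotZr).

Lemma enormN (R : realType) n (u : 'rV[R]_n) : enorm (- u) = enorm u.
Proof. by rewrite /enorm dotNl dotNr opprK. Qed.

Lemma enorm0 (R : realType) n : enorm (0 : 'rV[R]_n) = 0.
Proof. by rewrite /enorm dot0r sqrtr0. Qed.

Lemma enorm_distC (R : realType) n (u v : 'rV[R]_n) :
  enorm (u - v) = enorm (v - u).
Proof. by rewrite -enormN opprB. Qed.

Lemma enormZ (R : realType) n (a : R) (u : 'rV[R]_n) :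
  enorm (a *: u) = `|a| * enorm u.
Proof.
by rewrite /enorm dotZl dotZr mulrA -expr2 sqrtrM ?sqr_ge0// sqrtr_sqr.
Qed.

Lemma le_norm_enorm (R : realType) n (u : 'rV[R]_n) : `|u| <= enorm u.
Proof.
have [->|u0] := eqVneq u 0; first by rewrite normr0 enorm_ge0.
have /mx_norm_neq0[[i j]] : mx_norm u != 0 by rewrite -[mx_norm u]/`|u| normr_eq0.
rewrite -[mx_norm u]/`|u| => -> /=; rewrite (ord1 i).
rewrite -sqrtr_sqr; apply: ler_wsqrtr; rewrite /dot (bigD1 j)//= expr2 lerDl.
by apply: sumr_ge0 => k _; rewrite -expr2 sqr_ge0.
Qed.

(** The constant [n.+1] rather than the optimal square root of [n] keeps the
    bound positive in dimension 0. *)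
Lemma enorm_le_norm (R : realType) n (u : 'rV[R]_n) :
  enorm u <= n.+1%:R * `|u|.
Proof.
have coord i : `|u 0 i| <= `|u|.
  by rewrite [leRHS]mx_normrE (le_bigmax _ (fun ij => `|u ij.1 ij.2|) (0, i)).
rewrite -(@ler_pXn2r _ 2)// ?nnegrE ?enorm_ge0 ?mulr_ge0// enorm_sqr.
apply: (@le_trans _ _ (\sum_(i < n) `|u| ^+ 2)).
  apply: ler_sum => i _; rewrite -expr2 -[u 0 i ^+ 2]real_normK ?num_real//.
  by rewrite ler_pXn2r ?nnegrE.
rewrite sumr_const card_ord -[_ *+ n]mulr_natl exprMn ler_wpM2r ?sqr_ge0//.
by rewrite -natrX ler_nat (leq_trans (leqnSn n))// -mulnn leq_pmulr.
Qed.

Lemma enorm_eq0 (R : realType) n (u : 'rV[R]_n) : enorm u <= 0 -> u = 0.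
Proof.
move=> u0; apply/eqP; rewrite -normr_eq0 eq_le normr_ge0 andbT.
exact: le_trans (le_norm_enorm u) u0.
Qed.

Lemma dotuu_eq0 (R : realType) n (u : 'rV[R]_n) : dot u u <= 0 -> u = 0.
Proof.
move=> u0; apply: enorm_eq0; rewrite leNgt; apply/negP => /(exprn_gt0 2).
by rewrite enorm_sqr ltNge u0.
Qed.

Lemma enorm_gt0 (R : realType) n (u : 'rV[R]_n) : u != 0 -> 0 < enorm u.
Proof. by move=> u0; rewrite ltNge; apply: contra u0 => /enorm_eq0 ->. Qed.

(** Cauchy-Schwarz: the vector <v,v> u - <u,v> v has nonnegative square. *)
Lemma dot_enorm (R : realType) n (u v : 'rV[R]_n) :
  `|dot u v| <= enorm u * enorm v.
Proof.
have [->|v0] := eqVneq v 0; first by rewrite dot0r normr0 mulr_ge0 ?enorm_ge0.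
have vgt0 := enorm_gt0 v0.
rewrite -(@ler_pXn2r _ 2)// ?nnegrE ?normr_ge0 ?mulr_ge0 ?enorm_ge0//.
rewrite real_normK ?num_real// exprMn.
have := dotuu_ge0 (dot v v *: u - dot u v *: v).
rewrite !dotE (dotC v u) => h.
have v2 : 0 < dot v v by rewrite -enorm_sqr exprn_gt0.
have : 0 <= dot v v * (dot u u * dot v v - dot u v ^+ 2) by move: h; lra.
by rewrite pmulr_rge0// subr_ge0.
Qed.

Lemma dot_le (R : realType) n (u v : 'rV[R]_n) : dot u v <= enorm u * enorm v.
Proof. exact: le_trans (ler_norm _) (dot_enorm u v). Qed.

Lemma enormD (R : realType) n (u v : 'rV[R]_n) :
  enorm (u + v) <= enorm u + enorm v.
Proof.
rewrite -(@ler_pXn2r _ 2)// ?nnegrE ?addr_ge0 ?enorm_ge0//.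
have := dot_le u v; rewrite sqrrD !dotE (dotC v u); lra.
Qed.

Lemma dot_delta (R : realType) n (u : 'rV[R]_n) j :
  dot (delta_mx 0 j) u = u 0 j.
Proof.
rewrite /dot (bigD1 j)//= mxE !eqxx mul1r big1 ?addr0// => k kj.
by rewrite mxE (negPf kj) mul0r.
Qed.

(** The topology of row vectors comes from the sup norm; this restates it with
    Euclidean balls, the form in which every local statement below is used. *)
Lemma nbhs_enormP (R : realType) n (x : 'rV[R]_n) (A : set 'rV[R]_n) :
  nbhs x A <-> exists2 e : R, 0 < e & forall y, enorm (y - x) < e -> A y.
Proof.
split=> [/nbhs_normP[e /= e0 xA]|[e e0 xA]].
  exists e => // y yx; apply: xA; rewrite /ball_ /= distrC.
  exact: le_lt_trans (le_norm_enorm _) yx.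
apply/(nbhs_normP x A); exists (e / n.+1%:R) => /=; first by rewrite divr_gt0.
move=> y; rewrite /ball_ /= distrC ltr_pdivlMr// => yx; apply: xA.
by apply: le_lt_trans (enorm_le_norm _) _; rewrite mulrC.
Qed.

Lemma dot_linear (R : realType) n (v : 'rV[R]_n) :
  linear_for *:%R (dot v : 'rV[R]_n -> R^o).
Proof. by move=> a x y; rewrite dotDr dotZr. Qed.

HB.instance Definition _ (R : realType) n (v : 'rV[R]_n) :=
  GRing.isLinear.Build R 'rV[R]_n R^o *:%R (dot v : 'rV[R]_n -> R^o) (dot_linear v).

Lemma dot_continuous (R : realType) n (v : 'rV[R]_n) :
  continuous (dot v : 'rV[R]_n -> R^o).
Proof.
move=> x; apply/(@cvgrPdist_lt R R^o _ (nbhs x)) => e e0; apply/nbhs_enormP.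
exists (e / (enorm v + 1)).
  by rewrite divr_gt0// ltr_wpDl ?enorm_ge0.
move=> y; rewrite ltr_pdivlMr ?ltr_wpDl ?enorm_ge0// => yx.
rewrite /= -dotNr -dotDr; apply: le_lt_trans (dot_enorm _ _) _.
rewrite enorm_distC mulrC; apply: le_lt_trans yx.
by rewrite ler_wpM2l ?enorm_ge0// lerDl.
Qed.

Lemma cvg_dot (R : realType) n (us vs : nat -> 'rV[R]_n) u v :
  us @ \oo --> u -> vs @ \oo --> v -> dot (us t) (vs t) @[t --> \oo] --> dot u v.
Proof.
move=> uu vv; rewrite /dot.
have h (ws : nat -> 'rV[R]_n) (w : 'rV[R]_n) i :
    ws @ \oo --> w -> ws t 0 i @[t --> \oo] --> w 0 i.
  move=> ww; apply: (cvg_comp _ (fun M : 'rV[R]_n => M 0 i) ww).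
  exact: coord_continuous.
apply: (cvg_big add_continuous) => i _.
exact: cvgM (h _ _ i uu) (h _ _ i vv).
Qed.

(** * Operator norm and adjoint *)

Lemma dot_adjoint (R : realType) n m (L : {linear 'rV[R]_n -> 'rV[R]_m}) v u :
  dot (adjoint L v) u = dot v (L u).
Proof.
rewrite -(mul_rV_lin1 L) /dot /adjoint.
under eq_bigr do rewrite mxE mulr_suml.
under [RHS]eq_bigr do rewrite mxE mulr_sumr.
rewrite exchange_big /=; apply: eq_bigr => i _; apply: eq_bigr => j _.
by rewrite !mxE mulrAC -mulrA.
Qed.

(** Each coordinate of [L u] is the inner product of [u] with a row of the
    matrix, so Cauchy-Schwarz applies coordinatewise. *)
Lemma linear_enorm_bounded (R : realType) n m (L : {linear 'rV[R]_n -> 'rV[R]_m}) :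
  exists2 C : R, 0 <= C & forall u, enorm (L u) <= C * enorm u.
Proof.
pose D := \sum_(j < m) enorm (adjoint L (delta_mx 0 j)) ^+ 2.
have D0 : 0 <= D by apply: sumr_ge0 => j _; exact: sqr_ge0.
exists (Num.sqrt D) => [|u]; first exact: sqrtr_ge0.
rewrite -(@ler_pXn2r _ 2)// ?nnegrE ?mulr_ge0 ?enorm_ge0 ?sqrtr_ge0//.
rewrite exprMn (sqr_sqrtr D0) (enorm_sqr (L u)) /D {1}/dot mulr_suml.
apply: ler_sum => j _.
have <- : dot (adjoint L (delta_mx 0 j)) u = L u 0 j.
  by rewrite dot_adjoint dot_delta.
rewrite -expr2 -exprMn -[leLHS]real_normK ?num_real//.
by rewrite ler_pXn2r ?nnegrE ?mulr_ge0 ?enorm_ge0// dot_enorm.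
Qed.

Lemma opnorm_has_sup (R : realType) n m (L : {linear 'rV[R]_n -> 'rV[R]_m}) :
  has_sup [set enorm (L u) | u in [set u | enorm u <= 1]].
Proof.
have [C C0 LC] := linear_enorm_bounded L; split.
  by exists (enorm (L 0)), 0 => //=; rewrite enorm0 ler01.
exists C => _ [u /= u1 <-]; apply: le_trans (LC u) _.
by rewrite -[leRHS]mulr1 ler_wpM2l.
Qed.

Lemma enorm_le_opnorm (R : realType) n m (L : {linear 'rV[R]_n -> 'rV[R]_m}) u :
  enorm (L u) <= opnorm L * enorm u.
Proof.
have [->|u0] := eqVneq u 0; first by rewrite linear0 !enorm0 mulr0.
have uN := enorm_gt0 u0.
have : enorm (L ((enorm u)^-1 *: u)) <= opnorm L.
  apply: ub_le_sup; first exact: (opnorm_has_sup L).2.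
  exists ((enorm u)^-1 *: u) => //=.
  by rewrite enormZ ger0_norm ?invr_ge0 ?enorm_ge0// mulVf ?gt_eqF.
by rewrite linearZ enormZ ger0_norm ?invr_ge0 ?enorm_ge0// mulrC ler_pdivrMr.
Qed.

Lemma opnorm_ge0 (R : realType) n m (L : {linear 'rV[R]_n -> 'rV[R]_m}) : 0 <= opnorm L.
Proof.
apply: ub_le_sup; first exact: (opnorm_has_sup L).2.
by exists 0; rewrite /= ?linear0 enorm0 ?ler01.
Qed.

(** With a the adjoint image of v, |a|^2 = <v, L a> <= |v| |L| |a|. *)
Lemma adjoint_le_opnorm (R : realType) n m (L : {linear 'rV[R]_n -> 'rV[R]_m}) v :
  enorm (adjoint L v) <= opnorm L * enorm v.
Proof.
have [->|a0] := eqVneq (adjoint L v) 0.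
  by rewrite enorm0 mulr_ge0 ?opnorm_ge0 ?enorm_ge0.
have aN := enorm_gt0 a0; rewrite -(ler_pM2r aN) -expr2 enorm_sqr dot_adjoint.
apply: le_trans (dot_le _ _) _; rewrite [_ * enorm v]mulrC -mulrA.
by rewrite ler_wpM2l ?enorm_ge0// enorm_le_opnorm.
Qed.

Lemma adjointB (R : realType) n m (L : {linear 'rV[R]_n -> 'rV[R]_m}) u v :
  adjoint L (u - v) = adjoint L u - adjoint L v.
Proof. exact: mulmxBl. Qed.

(** * Gradients and quadratic models *)

Lemma diff_grad (R : realType) n (g : 'rV[R]_n -> R) (x v : 'rV[R]_n) :
  'd (g : 'rV[R]_n -> R^o) x v = dot (grad g x) v.
Proof.
rewrite [in LHS](row_sum_delta v) linear_sum /dot.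
by apply: eq_bigr => i _; rewrite linearZ /= mxE mulrC.
Qed.

Lemma is_derive_line (R : realType) n (g : 'rV[R]_n -> R) (x d : 'rV[R]_n) (t : R) :
  differentiable (g : 'rV[R]_n -> R^o) (x + t *: d) ->
  is_derive t (1 : R) (fun r : R => g (x + r *: d) : R) (dot (grad g (x + t *: d)) d).
Proof.
move=> dg.
(* the difference quotients of the restriction at [t] are those of [g] at
   [x + t *: d] along [d] *)
have quo : (fun h : R => h^-1 *:
      (((fun r : R => g (x + r *: d) : R) \o shift t) (h *: 1) - g (x + t *: d))) =
    (fun h : R => h^-1 *: ((g \o shift (x + t *: d)) (h *: d) - g (x + t *: d))).
  apply/funext => h /=; congr (_ *: (g _ - _)).
  by rewrite [h *: 1]mulr1 scalerDl addrCA.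
apply: DeriveDef.
  by rewrite /derivable quo; exact: (diff_derivable dg).
by rewrite /derive quo -diff_grad -deriveE.
Qed.

(** What the descent lemma says when [G] is the gradient of [g].  Keeping [G]
    abstract makes the property pass to g + h o L by adding the inequalities,
    without the chain rule. *)
Definition quad_model (R : realType) n (M : R) (g : 'rV[R]_n -> R)
    (G : 'rV[R]_n -> 'rV[R]_n) :=
  forall x y, `|g y - g x - dot (G x) (y - x)| <= M / 2 * enorm (y - x) ^+ 2.

Definition lipschitz_field (R : realType) n (M : R) (S : 'rV[R]_n -> 'rV[R]_n) :=
  forall x y, enorm (S x - S y) <= M * enorm (x - y).

(** Descent lemma.  The constant [M / 2] matters: it makes [g] weakly convex with
    constant [M] itself, which is what [gamma * M < 1] is tuned for.  It comes
    from the mean value theorem applied to the remainder along the segment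
    minus (or plus) [M / 2 * |t d|^2], which is monotone in [t]. *)
Lemma descent (R : realType) n (M : R) (g : 'rV[R]_n -> R) :
  lipschitz_differentiable M g -> quad_model M g (grad g).
Proof.
move=> [dg lg] x y; set d := y - x; set N := enorm d ^+ 2.
have dgl (t : R) := is_derive_line (dg (x + t *: d)).
have lin (t : R) : 0 < t ->
    `|dot (grad g (x + t *: d)) d - dot (grad g x) d| <= M * t * N.
  move=> t0; rewrite -dotNl -dotDl.
  apply: le_trans (dot_enorm _ _) _; rewrite /N expr2 mulrA ler_wpM2r ?enorm_ge0//.
  by apply: le_trans (lg _ _) _; rewrite addrC addKr enormZ gtr0_norm// mulrA.
(* used with [c = M] for the upper bound and [c = - M] for the lower one *)
pose p (c : R) (t : R) := g (x + t *: d) - t * dot (grad g x) d - c / 2 * N * (t * t).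
have dp c (t : R) : is_derive t (1 : R) (p c)
   (dot (grad g (x + t *: d)) d - dot (grad g x) d - c * N * t).
  have h1 : is_derive t (1 : R) (fun t : R => t * dot (grad g x) d : R) (dot (grad g x) d).
    have -> : (fun t : R => t * dot (grad g x) d : R) = dot (grad g x) d \*: id.
      by apply/funext => r /=; rewrite mulrC.
    by apply: is_derive_eq; rewrite [_ *: _]mulr1.
  have h2 : is_derive t (1 : R) (fun t : R => c / 2 * N * (t * t) : R) (c * N * t).
    have -> : (fun t : R => c / 2 * N * (t * t) : R) =
        (c / 2 * N) \*: (id * id : R -> R).
      by apply/funext.
    apply: is_derive_eq.
    by rewrite -[_ *: _]/(_ * _) -[t *: _]/(t * _) mulr1; lra.
  have -> : p c = (fun r : R => g (x + r *: d) : R)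
      - (fun t : R => t * dot (grad g x) d : R)
      - (fun t : R => c / 2 * N * (t * t) : R).
    by apply/funext.
  have h3 := is_deriveB (dgl t) h1.
  exact (is_deriveB h3 h2).
have mvt (c : R) : exists2 t, t \in `]0, 1[ & p c 1 - p c 0 =
   dot (grad g (x + t *: d)) d - dot (grad g x) d - c * N * t.
  have [|t t01 e] := MVT (@ltr01 R) (fun t _ => dp c t).
    apply: continuous_subspaceT => t.
    apply/differentiable_continuous/derivable1_diffP.
    exact: (@ex_derive _ _ _ _ _ _ _ (dp c t)).
  by exists t => //; rewrite e subr0 mulr1.
have pE (c : R) : p c 1 - p c 0 = g y - g x - dot (grad g x) d - c / 2 * N.
  by rewrite /p scale1r scale0r addr0 /d [x + _]addrC subrK; ring.
have {mvt pE} mvt (c : R) : exists t A,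
  [/\ 0 < t, `|A - dot (grad g x) d| <= M * t * N &
    g y - g x - dot (grad g x) d - c / 2 * N = A - dot (grad g x) d - c * N * t].
  have [t t01 e] := mvt c; have t0 : 0 < t by move: t01; rewrite in_itv/= => /andP[].
  by exists t, (dot (grad g (x + t *: d)) d); split => //; [exact: lin|rewrite -pE].
move: (dot (grad g x) d) (g y - g x) mvt => B G mvt.
rewrite ler_norml; apply/andP; split.
  have [t [A [t0 + e]]] := mvt (- M); rewrite ler_norml => /andP[+ _].
  by clear -e; lra.
have [t [A [t0 + e]]] := mvt M; rewrite ler_norml => /andP[_].
by clear -e; lra.
Qed.

(** A quadratic error is little-o of the displacement, which identifies the
    differential. *)
Lemma quadratic_differentiable (R : realType) n (F : 'rV[R]_n -> R)
    (x v : 'rV[R]_n) (C : R) :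
  (forall y, `|F y - F x - dot v (y - x)| <= C * enorm (y - x) ^+ 2) ->
  differentiable (F : 'rV[R]_n -> R^o) x /\ grad F x = v.
Proof.
move=> quad.
have exp : (F : 'rV[R]_n -> R^o) \o shift x =
    cst (F x) + (dot v : 'rV[R]_n -> R^o) +o_ (0 : 'rV[R]_n) id.
  apply/eqaddoP => e e0; apply/nbhs_enormP.
  pose D := `|C| * n.+1%:R + 1.
  have D0 : 0 < D by rewrite ltr_wpDl// mulr_ge0.
  exists (e / D) => [|y]; first by rewrite divr_gt0.
  rewrite subr0 ltr_pdivlMr// => ye; rewrite /= /shift.
  rewrite -[X in `|X| <= _]/(F (y + x) - (F x + dot v y)) opprD addrA.
  have := quad (y + x); rewrite addrK => /le_trans; apply.
  have C0 : 0 <= `|C| * enorm y by rewrite mulr_ge0 ?enorm_ge0.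
  apply: (@le_trans _ _ (`|C| * enorm y * (n.+1%:R * `|y|))).
    rewrite expr2 mulrA; apply: (@le_trans _ _ (`|C| * enorm y * enorm y)).
      by rewrite !ler_wpM2r ?enorm_ge0 ?ler_norm.
    by rewrite ler_wpM2l// enorm_le_norm.
  rewrite mulrA ler_wpM2r// mulrAC mulrC; apply: le_trans (ltW ye).
  by rewrite ler_wpM2l ?enorm_ge0// lerDl.
have dE := diff_unique (@dot_continuous R n v) exp.
split.
  apply/diff_locallyP; rewrite dE; split => //; exact: dot_continuous.
by apply/rowP => i; rewrite /grad mxE dE -[RHS]dot_delta dotC.
Qed.

Lemma quad_model_lb (R : realType) n (M : R) g (G : 'rV[R]_n -> 'rV[R]_n) x y :
  quad_model M g G -> g x + dot (G x) (y - x) - M / 2 * enorm (y - x) ^+ 2 <= g y.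
Proof. by move=> /(_ x y); rewrite ler_norml => /andP[+ _]; lra. Qed.

Lemma quad_model_ub (R : realType) n (M : R) g (G : 'rV[R]_n -> 'rV[R]_n) x y :
  quad_model M g G -> g y <= g x + dot (G x) (y - x) + M / 2 * enorm (y - x) ^+ 2.
Proof. by move=> /(_ x y); rewrite ler_norml => /andP[_]; lra. Qed.

(* Arithmetic below treats inner products, norms and gradients as atoms. *)
Opaque dot enorm grad.

Lemma grad0_littleo (R : realType) n (F : 'rV[R]_n -> R) (x : 'rV[R]_n) :
  differentiable (F : 'rV[R]_n -> R^o) x -> grad F x = 0 ->
  forall e, 0 < e -> exists2 d, 0 < d &
    forall y, enorm (y - x) < d -> `|F y - F x| <= e * enorm (y - x).
Proof.
move=> dF g0 e e0; have /diff_locally/eqaddoP/(_ e e0)/nbhs_enormP[d d0 Fd] := dF.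
exists d => // y yx; have := Fd (y - x); rewrite subr0 => /(_ yx).
rewrite -[X in `|X| <= _]/(F (y - x + x) - (F x + 'd F x (y - x))) subrK.
rewrite [X in F x + X]diff_grad g0 dotC dot0r addr0 => /le_trans; apply.
by rewrite ler_wpM2l ?le_norm_enorm// ltW.
Qed.

Lemma cvg_lipschitz_field (R : realType) n (K : R) (S : 'rV[R]_n -> 'rV[R]_n) x
    (us : nat -> 'rV[R]_n) :
  lipschitz_field K S -> us @ \oo --> x -> S (us t) @[t --> \oo] --> S x.
Proof.
move=> Slip ux; apply: cvg_comp ux _ => A /nbhs_enormP[e e0 eA]; apply/nbhs_enormP.
exists (e / (`|K| + 1)); first by rewrite divr_gt0// ltr_wpDl.
move=> y; rewrite ltr_pdivlMr ?ltr_wpDl// => yx; apply: eA.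
apply: le_lt_trans (Slip _ _) (le_lt_trans _ yx).
by rewrite mulrC ler_wpM2l ?enorm_ge0//; have := ler_norm K; lra.
Qed.

(** * Infima of an extended function plus a real function *)

(** Both the Moreau envelope and the forward-backward envelope are of this
    form, as functions of a parameter of [q]. *)
Definition infsum (R : realType) n (xi : 'rV[R]_n -> \bar R) (q : 'rV[R]_n -> R) :
    \bar R :=
  ereal_inf (range (fun u => xi u + (q u)%:E)%E).

Lemma infsum_ge (R : realType) n (xi : 'rV[R]_n -> \bar R)
    (q : 'rV[R]_n -> R) (c : R) :
  (forall u, xi u != -oo%E) -> (forall u b, xi u = b%:E -> c <= b + q u) ->
  (c%:E <= infsum xi q)%E.
Proof.
move=> xiN cq; apply: le_ereal_inf_tmp => _ [u _ <-].
case E : (xi u) (xiN u) (cq u) => [b||]// _ cb.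
  by rewrite -EFinD lee_fin cb.
by rewrite leey.
Qed.

Lemma infsum_le (R : realType) n (xi : 'rV[R]_n -> \bar R) (q : 'rV[R]_n -> R) u b :
  xi u = b%:E -> (infsum xi q <= (b + q u)%:E)%E.
Proof. by move=> xiu; apply: ereal_inf_lbound; exists u => //; rewrite xiu. Qed.

Lemma infsum_between (R : realType) n (xi : 'rV[R]_n -> \bar R)
    (q : 'rV[R]_n -> R) (c a : R) p :
  (forall u, xi u != -oo%E) -> (forall u b, xi u = b%:E -> c <= b + q u) ->
  xi p = a%:E -> exists r, [/\ infsum xi q = r%:E, c <= r & r <= a + q p].
Proof.
move=> xiN cq pa; have := infsum_le q pa; have := infsum_ge xiN cq.
case: (infsum xi q) => [r||]//; rewrite ?leeNy_eq// !lee_fin => cr ra.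
by exists r.
Qed.

Lemma infsum_addr_le (R : realType) n (xi : 'rV[R]_n -> \bar R)
    (q : 'rV[R]_n -> R) (c : R) :
  (infsum xi q + c%:E <= infsum xi (fun u => q u + c)%R)%E.
Proof.
apply: le_ereal_inf_tmp => _ [u _ <-]; rewrite EFinD addeA leeD2r//.
by apply: ereal_inf_lbound; exists u.
Qed.

Lemma infsum_addr (R : realType) n (xi : 'rV[R]_n -> \bar R)
    (q : 'rV[R]_n -> R) (c : R) :
  (infsum xi q + c%:E = infsum xi (fun u => q u + c)%R)%E.
Proof.
apply/eqP; rewrite eq_le infsum_addr_le/=.
have := infsum_addr_le xi (fun u => q u + c) (- c).
have -> : (fun u => q u + c - c) = q by apply/funext => u; rewrite addrK.
by rewrite EFinN leeBlDr.
Qed.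

(** * Weak convexity and the proximal mapping *)

(** The identity |t x + (1 - t) y|^2 = t |x|^2 + (1 - t) |y|^2
    - t (1 - t) |x - y|^2 turns the convexity of the shifted function into an
    inequality on the function itself, with an explicit defect. *)
Lemma weakly_convex_le (R : realType) n (beta : R) (xi : 'rV[R]_n -> \bar R)
    x y (a b t : R) :
  weakly_convex beta xi -> xi x = a%:E -> xi y = b%:E -> 0 <= t <= 1 ->
  (xi (t *: x + (1 - t) *: y)%R
    <= (t * a + (1 - t) * b + beta / 2 * (t * (1 - t)) * enorm (x - y) ^+ 2)%R%:E)%E.
Proof.
move=> xic xa yb t01; have := xic x y t t01; rewrite xa yb.
rewrite -!EFinD -leeBrDr// -EFinB => /le_trans; apply.
rewrite lee_fin le_eqVlt; apply/orP; left; apply/eqP.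
rewrite !dotE (dotC y x); move: (dot x x) (dot x y) (dot y y) => xx xy yy; lra.
Qed.

(** The proximal objective is strongly convex with modulus [gamma^-1 - beta]; at
    the midpoint of two near-minimizers it would drop below the infimum if they
    were far apart.  This one estimate gives the Cauchy property of minimizing
    sequences, quadratic growth at the minimizer and uniqueness. *)
Lemma near_minimizers_close (R : realType) n (beta gamma : R)
    (xi : 'rV[R]_n -> \bar R) z (m e : R) x y (a b : R) :
  let q u := (2 * gamma)^-1 * enorm (u - z) ^+ 2 in
  weakly_convex beta xi -> (forall u, xi u != -oo%E) ->
  (forall u c, xi u = c%:E -> m <= c + q u) ->
  xi x = a%:E -> xi y = b%:E -> a + q x <= m + e -> b + q y <= m + e ->
  (gamma^-1 - beta) / 8 * enorm (x - y) ^+ 2 <= e.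
Proof.
move=> q xic xiN mq xa yb ae be.
have h01 : 0 <= (2^-1 : R) <= 1 by lra.
have := weakly_convex_le xic xa yb h01; set w := _ + _ *: y.
case E : (xi w) (xiN w) => [c||]// _; rewrite lee_fin => cle.
have := mq w c E; have qw : q w = (q x + q y) / 2 - gamma^-1 / 8 * enorm (x - y) ^+ 2.
  rewrite /q /w invfM !dotE (dotC y x) !(dotC z); move: (gamma^-1) => g'.
  by lra.
rewrite qw; lra.
Qed.

(** Apply the closeness of near-minimizers to the minimizer [p] and to [u],
    which is a near-minimizer up to its own excess value. *)
Lemma prox_growth (R : realType) n (beta gamma : R) (xi : 'rV[R]_n -> \bar R)
    z p u (a b : R) :
  weakly_convex beta xi -> (forall u, xi u != -oo%E) -> prox gamma xi z p ->
  xi p = a%:E -> xi u = b%:E ->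
  a + (2 * gamma)^-1 * enorm (p - z) ^+ 2 + (gamma^-1 - beta) / 8 * enorm (u - p) ^+ 2
   <= b + (2 * gamma)^-1 * enorm (u - z) ^+ 2.
Proof.
move=> xic xiN pmin pa ub.
have pm v c : xi v = c%:E ->
    a + (2 * gamma)^-1 * enorm (p - z) ^+ 2 <= c + (2 * gamma)^-1 * enorm (v - z) ^+ 2.
  by move=> vc; have := pmin v; rewrite pa vc -!EFinD lee_fin.
have ub' := pm u b ub.
set A := a + _ in pm ub' *; set B := b + _ in ub' *.
have := near_minimizers_close (z := z) (gamma := gamma) (m := A) (e := B - A)
  xic xiN pm ub pa.
rewrite [A + (B - A)]addrC subrK => /(_ (lexx _) ub'); rewrite lerBrDl; exact.
Qed.

Lemma prox_fin (R : realType) n gamma (xi : 'rV[R]_n -> \bar R) z p :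
  eproper xi -> prox gamma xi z p -> exists a, xi p = a%:E.
Proof.
move=> [xiN [v vfin]] /(_ v); case: (xi p) (xiN p) => [a||]// _; first by exists a.
by case: (xi v) (xiN v) vfin => [b||]// _ _; rewrite addye// leye_eq.
Qed.

Lemma prox_unique (R : realType) n (beta gamma : R) (xi : 'rV[R]_n -> \bar R) z p p' :
  beta < gamma^-1 -> eproper xi -> weakly_convex beta xi ->
  prox gamma xi z p -> prox gamma xi z p' -> p' = p.
Proof.
move=> bg xip xic pz pz'; have [a pa] := prox_fin xip pz.
have [a' pa'] := prox_fin xip pz'.
have := prox_growth xic xip.1 pz pa pa'.
have := pz' p; rewrite pa pa' -!EFinD lee_fin => h1 h2.
apply/eqP; rewrite -subr_eq0; apply/eqP/dotuu_eq0; rewrite -enorm_sqr.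
have sg0 : 0 < (gamma^-1 - beta) / 8 by rewrite divr_gt0// subr_gt0.
by rewrite -(pmulr_rle0 _ sg0); lra.
Qed.

(** Minimizing sequences are Cauchy by strong convexity, so completeness and
    lower semicontinuity give a minimizer.  The minorant with constant
    [mu < gamma^-1] is there to bound the objective from below. *)
Lemma prox_exists (R : realType) n (beta mu gamma c : R) (xi : 'rV[R]_n -> \bar R) z :
  0 < gamma -> beta < gamma^-1 -> mu < gamma^-1 ->
  eproper xi -> lower_semicontinuous xi -> weakly_convex beta xi ->
  (forall x, (c%:E <= xi x + (mu / 2 * enorm x ^+ 2)%:E)%E) ->
  exists p, prox gamma xi z p.
Proof.
move=> g0 bg mug [xiN [v vfin]] lsc xic below.
pose q u := (2 * gamma)^-1 * enorm (u - z) ^+ 2.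
pose A := [set r | exists2 u : 'rV[R]_n, True & xi u = (r - q u)%:E].
have infA : has_inf A.
  split.
    case E : (xi v) (xiN v) vfin => [b||]// _ _.
    by exists (b + q v); exists v => //; rewrite addrK.
  (* minimum over [u] of the quadratic that bounds the objective from below *)
  exists (c + gamma^-1 / 2 * dot z z
    - (2 * (gamma^-1 - mu))^-1 * dot (gamma^-1 *: z) (gamma^-1 *: z)) => r [u _ E].
  have := below u; rewrite E -EFinD lee_fin.
  have d0 : 0 < gamma^-1 - mu by rewrite subr_gt0.
  set d := gamma^-1 - mu in d0 *.
  have := dotuu_ge0 (u - d^-1 *: (gamma^-1 *: z)).
  rewrite /q invfM !dotE (dotC z u); move: (dot u u) (dot u z) (dot z z) => uu uz zz.
  have -> : mu = gamma^-1 - d by rewrite /d; lra.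
  rewrite (invfM 2 d); have : d * d^-1 = 1 by rewrite mulfV ?gt_eqF.
  clearbody d; move: (gamma^-1) (d^-1) => g' i di /(mulr_ge0 (ltW d0)).
  rewrite (_ : d * _ = d * uu - 2 * (d * i) * (g' * uz)
                     + (d * i) * (i * (g' * (g' * zz)))); last by ring.
  by rewrite di; lra.
set m := inf A.
have mle u b : xi u = b%:E -> m <= b + q u.
  by move=> E; apply: ge_inf => //; [exact: infA.2|exists u => //; rewrite addrK].
have /choice[u uP] k : exists u, exists2 b, xi u = b%:E & b + q u <= m + k.+1%:R^-1.
  have [r [u _ E] rm] := @inf_adherent _ A k.+1%:R^-1 ltac:(by rewrite invr_gt0) infA.
  by exists u, (r - q u) => //; rewrite subrK ltW.
have sg : 0 < (gamma^-1 - beta) / 8 by rewrite divr_gt0// subr_gt0.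
have close k l : (k <= l)%N ->
    (gamma^-1 - beta) / 8 * enorm (u k - u l) ^+ 2 <= k.+1%:R^-1.
  move=> kl; have [a Ea ak] := uP k; have [b Eb bl] := uP l.
  apply: near_minimizers_close xic xiN mle Ea Eb ak _.
  by apply: le_trans bl _; rewrite lerD2l lef_pV2 ?posrE// ler_nat.
have /cauchy_cvg cu : cauchy (u @ \oo).
  apply: cauchy_exP => e e0.
  have e1 : 0 < (gamma^-1 - beta) / 8 * e ^+ 2 by rewrite mulr_gt0// exprn_gt0.
  have [N _ /(_ N (leqnn N))/= NP] := near_infty_natSinv_lt (PosNum e1).
  exists (u N); exists N => // k /= Nk; rewrite -ball_normE /=.
  apply: le_lt_trans (le_norm_enorm _) _.
  rewrite -(@ltr_pXn2r _ 2)// ?nnegrE ?enorm_ge0 ?ltW//.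
  by rewrite -(ltr_pM2l sg); apply: le_lt_trans (close _ _ Nk) NP.
pose p : 'rV[R]_n := limn u; have up : u @ \oo --> p := cu.
have pm : (xi p + (q p)%:E <= m%:E)%E.
  rewrite leNgt; apply/negP => mp.
  (* a real number [a] separating [m - q p] from [xi p], which may be infinite *)
  have [a ma ap] : exists2 a, m - q p < a & (a%:E < xi p)%E.
    case E : (xi p) (xiN p) mp => [b||]// _.
      rewrite -EFinD lte_fin => h.
      by exists ((m - q p + b) / 2); rewrite ?lte_fin; lra.
    by move=> _; exists (m - q p + 1); rewrite ?ltry// ltrDl.
  pose d := a - (m - q p); have d0 : 0 < d by rewrite subr_gt0.
  have [V pV Va] := lsc p a ap.
  have qnear : nbhs p [set w | q p - d / 2 < q w].
    apply/nbhs_enormP; exists (d / 2 / (gamma^-1 * (enorm (p - z) + 1))).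
      by rewrite !divr_gt0// mulr_gt0 ?invr_gt0// ltr_wpDl ?enorm_ge0.
    move=> w; rewrite ltr_pdivlMr; last first.
      by rewrite mulr_gt0 ?invr_gt0// ltr_wpDl ?enorm_ge0.
    move=> wd /=; have := dot_enorm (p - z) (w - p); rewrite ler_norml => /andP[pw _].
    have qw : q w = q p + gamma^-1 * dot (p - z) (w - p)
                      + gamma^-1 / 2 * dot (w - p) (w - p).
      rewrite /q invfM !dotE (dotC w p) !(dotC z); move: (gamma^-1) => g'.
      by lra.
    have g'0 : 0 < gamma^-1 by rewrite invr_gt0.
    have m1 := mulr_ge0 (ltW g'0) (dotuu_ge0 (w - p)).
    have m2 := mulr_ge0 (ltW g'0) (enorm_ge0 (w - p)).
    move: pw; rewrite -subr_ge0 opprK => /(mulr_ge0 (ltW g'0)).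
    rewrite qw; move: wd m1 m2; move: (gamma^-1) (dot _ _) (enorm (w - p)) (enorm _).
    move=> g' ? ? ?; lra.
  have vu : nbhs p (V `&` [set w | q p - d / 2 < q w]) by apply: filterI.
  have [N1 _ N1P] := up _ vu.
  have d2 : 0 < d / 2 by rewrite divr_gt0.
  have [N2 _ N2P] := near_infty_natSinv_lt (PosNum d2).
  have [/= Vk qk] := N1P (maxn N1 N2) (leq_maxl _ _).
  have k2 : (maxn N1 N2).+1%:R^-1 < d / 2 := N2P (maxn N1 N2) (leq_maxr _ _).
  have [b Eb bk] := uP (maxn N1 N2).
  have := Va _ Vk; rewrite Eb lte_fin => ab.
  move: (maxn N1 N2).+1%:R^-1 (q (u _)) qk k2 bk => i qu; rewrite /d; lra.
exists p => w /=; apply: le_trans pm _.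
case E : (xi w) (xiN w) => [b||]// _; last by rewrite leey.
by rewrite -EFinD lee_fin mle.
Qed.

(** Differentiability of the Moreau envelope at [z], with gradient
    (z - p) / gamma, in quantitative form.  Testing the infimum at [y] with the
    minimizer [p] for [z] gives the upper bound; the lower bound holds because
    the growth of the objective at [p] absorbs the cross term between [y - z]
    and [u - p]. *)
Lemma moreau_quadratic (R : realType) n (beta gamma : R) (xi : 'rV[R]_n -> \bar R) z p :
  0 < gamma -> beta < gamma^-1 -> eproper xi -> weakly_convex beta xi ->
  prox gamma xi z p ->
  exists C, forall y, `|fine (moreau gamma xi y) - fine (moreau gamma xi z)
                        - dot (gamma^-1 *: (z - p)) (y - z)| <= C * enorm (y - z) ^+ 2.
Proof.
move=> g0 bg xip xic pz; have [a pa] := prox_fin xip pz.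
have g'0 : 0 < gamma^-1 by rewrite invr_gt0.
pose sg := gamma^-1 - beta; have sg0 : 0 < sg by rewrite subr_gt0.
pose C := gamma^-1 / 2 + 2 * gamma^-1 ^+ 2 / sg.
pose b0 := a + (2 * gamma)^-1 * enorm (p - z) ^+ 2.
have C0 : 0 <= 2 * gamma^-1 ^+ 2 / sg by rewrite divr_ge0 ?mulr_ge0 ?sqr_ge0// ltW.
have bounds y : exists r, [/\ moreau gamma xi y = r%:E,
   b0 + dot (gamma^-1 *: (z - p)) (y - z) - C * enorm (y - z) ^+ 2 <= r &
   r <= b0 + dot (gamma^-1 *: (z - p)) (y - z) + C * enorm (y - z) ^+ 2].
  have [|r [rE rl ru]] := @infsum_between R n xi
    (fun u => (2 * gamma)^-1 * enorm (y - u) ^+ 2)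
    (b0 + dot (gamma^-1 *: (z - p)) (y - z) - C * enorm (y - z) ^+ 2) a p xip.1 _ pa.
    move=> u b ub; have := prox_growth xic xip.1 pz pa ub.
    rewrite -/b0 -/sg /C; clearbody sg.
    have -> : y - u = (y - z) - (u - p) + (z - p) by row_ring.
    have -> : u - z = (u - p) - (z - p) by row_ring.
    have := mulr_ge0 (ltW g'0) (dotuu_ge0 (y - z)).
    move: (y - z) (u - p) (z - p) b0 => d e w B.
    (* Young's inequality for the cross term, as the square of the vector that
       vanishes at its equality case *)
    have := dotuu_ge0 (e - (4 * gamma^-1 / sg) *: d).
    rewrite invfM !dotE (dotC d e) (dotC w e) (dotC w d).
    have ii : sg * sg^-1 = 1 by rewrite mulfV ?gt_eqF.
    move: (dot _ _) (dot e d) (dot e w) (dot d d) (dot d w) (dot w w) (sg^-1) (gamma^-1) ii.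
    move=> ee ed ew dd dw ww i g' ii.
    move=> /(mulr_ge0 (ltW sg0)).
    rewrite (_ : sg * (_ + _) = sg * ee - 8 * (sg * i) * g' * ed
                         + 16 * (sg * i) * i * g' ^+ 2 * dd); last by ring.
    by rewrite ii; lra.
  exists r; split => //; apply: le_trans ru _.
  have -> : y - p = (y - z) + (z - p) by row_ring.
  rewrite /b0 (enorm_distC p) /C (mulrDl (gamma^-1 / 2)).
  have := mulr_ge0 C0 (sqr_ge0 (enorm (y - z))).
  move: (_ / sg * _) => X; move: (y - z) (z - p) => d w; rewrite invfM !dotE (dotC w d).
  by move: (dot _ _) (dot _ _) (dot _ _) (gamma^-1) => *; lra.
have [r0 [r0E r0l r0u]] := bounds z.
have r0b : r0 = b0.
  apply/le_anti; move: r0l r0u; rewrite subrr dot0r enorm0 expr0n mulr0 subr0 !addr0.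
  by move=> -> ->.
exists C => y; have [r [rE rl ru]] := bounds y.
rewrite r0E rE r0b /= ler_norml; apply/andP; split.
  by rewrite lerBrDr lerBrDr; lra.
by rewrite !lerBlDr; lra.
Qed.

(** * The proximal mapping of a smooth function *)

(** At a point of a chord, weigh the model lower bounds of the two endpoints by
    [t] and [1 - t]; the linear terms cancel. *)
Lemma quad_model_weakly_convex (R : realType) n (M : R) g (G : 'rV[R]_n -> 'rV[R]_n) :
  quad_model M g G -> weakly_convex M (EFin \o g).
Proof.
move=> gG x y t /andP[t0 t1]; set w := t *: x + _.
rewrite -!EFinD lee_fin.
have := quad_model_lb w x gG; have := quad_model_lb w y gG.
have -> : x - w = (1 - t) *: (x - y).
  by rewrite /w; row_ring.
have -> : y - w = (- t) *: (x - y).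
  by rewrite /w; row_ring.
rewrite /w; set D := G _; move: (g _) => gw.
have := subr_ge0 t 1; rewrite t1 => t1'.
move=> /(ler_wpM2l t1') + /(ler_wpM2l t0).
rewrite !dotE (dotC y x).
move: (g x) (g y) (dot x x) (dot x y) (dot y y) (dot D x) (dot D y) => *; lra.
Qed.

Lemma quad_model_below (R : realType) n (M mu : R) g (G : 'rV[R]_n -> 'rV[R]_n) :
  quad_model M g G -> M < mu ->
  exists c : R, forall x, (c%:E <= (EFin \o g) x + (mu / 2 * enorm x ^+ 2)%:E)%E.
Proof.
move=> gG Mmu; have d0 : 0 < mu - M by rewrite subr_gt0.
exists (g 0 - 2^-1 * (mu - M)^-1 * dot (G 0) (G 0)) => x.
rewrite -EFinD lee_fin; have := quad_model_lb 0 x gG; rewrite subr0.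
have -> : mu = M + (mu - M) by lra.
move: (mu - M) d0 => d d0; have -> : M + d - M = d by lra.
have := dotuu_ge0 (x + d^-1 *: G 0); have : d * d^-1 = 1 by rewrite mulfV ?gt_eqF.
rewrite !dotE (dotC x (G 0)).
move: (dot x x) (dot (G 0) x) (dot (G 0) (G 0)) (d^-1) => xx xg gg i di.
move=> /(mulr_ge0 (ltW d0)).
rewrite (_ : d * (_ + _) = d * xx + 2 * (d * i) * xg + (d * i) * i * gg); last by ring.
by rewrite di; lra.
Qed.

(** Optimality condition.  If [w = G x + (x - z) / gamma] were not zero, the
    gradient step of length [gamma] along [- w] would lower the objective,
    since [gamma * M < 1]. *)
Lemma quad_model_proxP (R : realType) n (M gamma : R) g (G : 'rV[R]_n -> 'rV[R]_n) x z :
  0 < gamma -> M < gamma^-1 -> quad_model M g G ->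
  prox gamma (EFin \o g) z x <-> x + gamma *: G x = z.
Proof.
move=> g0 Mg gG; split=> [xz|<- v].
  pose w := G x + gamma^-1 *: (x - z).
  have w0 : gamma / 2 * (1 - gamma * M) * dot w w <= 0.
    have := xz (x - gamma *: w); rewrite -!EFinD lee_fin.
    have := quad_model_ub x (x - gamma *: w) gG.
    have -> : x - gamma *: w - x = - (gamma *: w) by rewrite addrAC subrr sub0r.
    have -> : x - gamma *: w - z = (x - z) - gamma *: w by rewrite addrAC.
    have -> : G x = w - gamma^-1 *: (x - z) by rewrite addrK.
    clearbody w; move: (x - gamma *: w) (x - z) => v d.
    have : gamma * gamma^-1 = 1 by rewrite mulfV ?gt_eqF.
    rewrite invfM !dotE (dotC d w).
    move: (gamma^-1) (dot w w) (dot w d) (dot d d) (g x) (g v) => g' ww wd dd gx gv gg'.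
    have e1 : gamma * g' * wd = wd by rewrite gg' mul1r.
    have e2 : gamma * g' * (gamma * ww) = gamma * ww by rewrite gg' mul1r.
    by lra.
  have {}w0 : w = 0.
    apply: dotuu_eq0; move: w0; rewrite pmulr_rle0// mulr_gt0 ?divr_gt0// subr_gt0.
    by rewrite -[ltRHS](mulfV (lt0r_neq0 g0)) ltr_pM2l.
  have : gamma *: w = 0 by rewrite w0 scaler0.
  rewrite /w scalerDr scalerA mulfV ?gt_eqF// scale1r addrCA => /eqP.
  by rewrite addrA subr_eq0 => /eqP.
rewrite -!EFinD lee_fin; have := quad_model_lb x v gG.
have -> : x - (x + gamma *: G x) = - (gamma *: G x) by rewrite opprD addNKr.
have -> : v - (x + gamma *: G x) = (v - x) - gamma *: G x by rewrite opprD addrA.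
have : 0 <= (gamma^-1 - M) * dot (v - x) (v - x).
  by rewrite mulr_ge0 ?dotuu_ge0// subr_ge0 ltW.
move: (v - x) (G x) => d w; have : gamma * gamma^-1 = 1 by rewrite mulfV ?gt_eqF.
rewrite invfM !dotE (dotC d w).
move: (gamma^-1) (dot w w) (dot w d) (dot d d) (g x) (g v) => g' ww wd dd gx gv gg'.
have e1 : gamma * g' * wd = wd by rewrite gg' mul1r.
by lra.
Qed.

(** The optimality condition determines the proximal point once one is known to
    exist; existence comes from the strong convexity of the proximal objective,
    with any minorant constant between [M] and [gamma^-1]. *)
Lemma quad_model_prox_pt (R : realType) n (M gamma : R) g (G : 'rV[R]_n -> 'rV[R]_n) :
  0 < gamma -> M < gamma^-1 -> quad_model M g G ->
  forall z x, prox_pt gamma (EFin \o g) z = x <-> x + gamma *: G x = z.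
Proof.
move=> g0 Mg gG z x.
have gcont y := differentiable_continuous (quadratic_differentiable (gG y)).1.
have gp : eproper (EFin \o g) by split=> //; exists 0; rewrite ltry.
have glsc : lower_semicontinuous (EFin \o g).
  move=> y a; rewrite lte_fin => ay; exists [set w | a < g w] => //.
  by have /cvgr_gt := gcont y; apply.
have gwc := quad_model_weakly_convex gG.
have Mmid : M < (M + gamma^-1) / 2 by lra.
have [c cb] := quad_model_below gG Mmid.
have [|p pz] := @prox_exists _ _ M _ gamma c (EFin \o g) z g0 Mg _ gp glsc gwc cb.
  by lra.
have ptz : prox gamma (EFin \o g) z (prox_pt gamma (EFin \o g) z).
  exact: (getPex (ex_intro _ p pz)).
split=> [<-|xz]; first by apply/(quad_model_proxP _ z g0 Mg gG).
apply: (prox_unique Mg gp gwc _ ptz).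
exact/(quad_model_proxP x z g0 Mg gG).
Qed.

Lemma forward_step_lipschitz (R : realType) n (gamma M : R) (G : 'rV[R]_n -> 'rV[R]_n) :
  0 < gamma -> lipschitz_field M G ->
  lipschitz_field (1 + gamma * M) (fun x => x + gamma *: G x).
Proof.
move=> g0 GM x y.
have -> : x + gamma *: G x - (y + gamma *: G y) =
    (x - y) + gamma *: (G x - G y) by row_ring.
apply: le_trans (enormD _ _) _; rewrite enormZ gtr0_norm// mulrDl mul1r lerD2l -mulrA.
by rewrite ler_pM2l.
Qed.

(** The identity dominates the perturbation [gamma *: G], which is Lipschitz with
    constant [gamma * M < 1]; so the forward step cannot shrink distances by
    more than the factor [1 - gamma * M]. *)
Lemma forward_step_inv_lipschitz (R : realType) n (gamma M : R)
    (G P : 'rV[R]_n -> 'rV[R]_n) :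
  0 < gamma -> M < gamma^-1 -> lipschitz_field M G ->
  (forall z, P z + gamma *: G (P z) = z) ->
  lipschitz_field (1 - gamma * M)^-1 P.
Proof.
move=> g0 Mg GM PK y z; rewrite -{2}[y]PK -{2}[z]PK.
move: (P y) (P z) => u v.
have del : 0 < 1 - gamma * M.
  by rewrite subr_gt0 -[ltRHS](mulfV (lt0r_neq0 g0)) ltr_pM2l.
rewrite ler_pdivlMl//.
have := enormD (u + gamma *: G u - (v + gamma *: G v)) (gamma *: (G v - G u)).
have -> : u + gamma *: G u - (v + gamma *: G v) + gamma *: (G v - G u) = u - v.
  by row_ring.
rewrite enormZ gtr0_norm//; have := GM v u; rewrite -(ler_pM2l g0) (enorm_distC v).
by move: (enorm _) (enorm _) => *; lra.
Qed.

(** * The forward-backward envelope *)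

(** With [S] the gradient of [s], the forward-backward envelope of f + s, written
    as the infimum of its linearized and regularized model at [x] rather than
    through the Moreau envelope of [f]: moving [x] with [u] fixed is then easy
    to estimate. *)
Definition fbe (R : realType) n (gamma : R) (f : 'rV[R]_n -> \bar R)
    (s : 'rV[R]_n -> R) (S : 'rV[R]_n -> 'rV[R]_n) (x : 'rV[R]_n) : \bar R :=
  infsum f (fun u => s x + dot (S x) (u - x) + (2 * gamma)^-1 * enorm (u - x) ^+ 2).

(** The square |u - x + gamma v|^2 / (2 gamma) expands into the linear term of
    slope [v], the proximal term at [x] and a constant independent of [u]. *)
Lemma prox_step_ineq (R : realType) n (gamma : R) (f : 'rV[R]_n -> \bar R)
    x v p (a b : R) u :
  0 < gamma -> prox gamma f (x - gamma *: v) p -> f p = a%:E -> f u = b%:E ->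
  a + dot v (p - x) + (2 * gamma)^-1 * enorm (p - x) ^+ 2 <=
  b + dot v (u - x) + (2 * gamma)^-1 * enorm (u - x) ^+ 2.
Proof.
move=> g0 /(_ u) + pa ub; rewrite pa ub -!EFinD lee_fin.
have -> : p - (x - gamma *: v) = (p - x) + gamma *: v by row_ring.
have -> : u - (x - gamma *: v) = (u - x) + gamma *: v by row_ring.
move: (p - x) (u - x) => d e; rewrite invfM !dotE !(dotC _ v).
have : gamma * gamma^-1 = 1 by rewrite mulfV ?gt_eqF.
move: (gamma^-1) (dot d d) (dot e e) (dot v d) (dot v e) (dot v v) => g' dd ee vd ve vv gg'.
have e1 : gamma * g' * vd = vd by rewrite gg' mul1r.
have e2 : gamma * g' * ve = ve by rewrite gg' mul1r.
by lra.
Qed.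

Lemma fbe_prox (R : realType) n (gamma : R) (f : 'rV[R]_n -> \bar R) s S x p (a : R) :
  0 < gamma -> eproper f -> prox gamma f (x - gamma *: S x) p -> f p = a%:E ->
  fbe gamma f s S x =
    (a + (s x + dot (S x) (p - x) + (2 * gamma)^-1 * enorm (p - x) ^+ 2))%:E.
Proof.
move=> g0 fp pz pa.
have [u b ub|r [rE rl ru]] := @infsum_between R n f
   (fun u => s x + dot (S x) (u - x) + (2 * gamma)^-1 * enorm (u - x) ^+ 2)
   (a + (s x + dot (S x) (p - x) + (2 * gamma)^-1 * enorm (p - x) ^+ 2)) a p fp.1 _ pa.
  by have := prox_step_ineq g0 pz pa ub; lra.
by rewrite /fbe rE; congr EFin; apply/le_anti; rewrite ru rl.
Qed.

(** Keep [u = p] in the infimum while the base point moves from [x] towards [p].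
    The proximal term falls at rate |p - x|^2 / gamma, while the smooth terms
    give back at most K |p - x|^2 as [S] is [K]-Lipschitz. *)
Lemma fbe_decrease (R : realType) n (gamma K : R) (f : 'rV[R]_n -> \bar R)
    s S x p (t : R) :
  0 < gamma -> K < gamma^-1 -> eproper f ->
  quad_model K s S -> lipschitz_field K S ->
  prox gamma f (x - gamma *: S x) p -> 0 <= t <= 1 ->
  (fbe gamma f s S (x + t *: (p - x))%R <=
   fbe gamma f s S x - ((gamma^-1 - K) / 2 * t * enorm (p - x) ^+ 2)%:E)%E.
Proof.
move=> g0 Kg fp sS Slip pz /andP[t0 t1]; have [a pa] := prox_fin fp pz.
rewrite (fbe_prox s g0 fp pz pa) -EFinB; apply: le_trans (infsum_le _ pa) _.
rewrite lee_fin; have := quad_model_ub x (x + t *: (p - x)) sS.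
have -> : x + t *: (p - x) - x = t *: (p - x) by row_ring.
have -> : p - (x + t *: (p - x)) = (1 - t) *: (p - x) by row_ring.
have := Slip (x + t *: (p - x)) x.
have -> : x + t *: (p - x) - x = t *: (p - x) by row_ring.
rewrite enormZ (ger0_norm t0); move: (x + _) => x'; move: (p - x) => w.
have := dot_le (S x' - S x) w => h1 /(ler_wpM2r (enorm_ge0 w)) /(le_trans h1).
rewrite -!mulrA -expr2 => /(ler_wpM2l (_ : 0 <= 1 - t)); rewrite subr_ge0 => /(_ t1).
have : 0 <= (gamma^-1 - K) * t * (1 - t) * dot w w.
  by rewrite !mulr_ge0 ?dotuu_ge0// subr_ge0// ltW.
rewrite invfM ?exprMn !dotE.
move: (gamma^-1) (dot w w) (dot (S x') w) (dot (S x) w) (s x) (s x') => *; lra.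
Qed.

(** Testing the infimum at [y] with [u = x] gives the upper bound.  For the lower
    bound, the growth of the forward-backward objective at its minimizer [x]
    absorbs the term of order |y - x| |u - x| that comes from replacing [S x]
    by [S y] and the base point [x] by [y]. *)
Lemma fbe_flat (R : realType) n (gamma beta K : R) (f : 'rV[R]_n -> \bar R) s S x :
  0 < gamma -> beta < gamma^-1 -> eproper f -> weakly_convex beta f ->
  quad_model K s S -> lipschitz_field K S -> prox gamma f (x - gamma *: S x) x ->
  exists a C, forall y, exists2 r, fbe gamma f s S y = r%:E &
    `|r - a| <= C * enorm (y - x) ^+ 2.
Proof.
move=> g0 bg fp fwc sS Slip xz; have [a xa] := prox_fin fp xz.
have g'0 : 0 < gamma^-1 by rewrite invr_gt0.
pose sg := gamma^-1 - beta; have sg0 : 0 < sg by rewrite subr_gt0.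
(* coefficient of the cross term |y - x| |u - x| *)
pose L := K + gamma^-1.
have Q0 : 0 <= 2 * L ^+ 2 / sg by rewrite divr_ge0 ?(ltW sg0)// mulr_ge0 ?sqr_ge0.
exists (a + s x), (L / 2 + 2 * L ^+ 2 / sg) => y.
have [u b ub|r [rE rl ru]] := @infsum_between R n f
   (fun u => s y + dot (S y) (u - y) + (2 * gamma)^-1 * enorm (u - y) ^+ 2)
   (a + s x - (L / 2 + 2 * L ^+ 2 / sg) * enorm (y - x) ^+ 2) a x fp.1 _ xa.
  have := prox_growth fwc fp.1 xz xa ub; rewrite -/sg.
  have := quad_model_ub y x sS; have := Slip y x.
  have -> : x - (x - gamma *: S x) = gamma *: S x by row_ring.
  have -> : u - (x - gamma *: S x) = (u - x) + gamma *: S x by row_ring.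
  have -> : u - y = (u - x) - (y - x) by row_ring.
  have -> : x - y = - (y - x) by row_ring.
  move: (y - x) (u - x) => d e h1.
  have : 0 <= dot (S y - S x) e + K * (enorm d * enorm e).
    have := dot_enorm (S y - S x) e; rewrite ler_norml => /andP[+ _].
    have := ler_wpM2r (enorm_ge0 e) h1; rewrite -mulrA; lra.
  have de : 0 <= gamma^-1 * (enorm d * enorm e - dot d e).
    by rewrite mulr_ge0 ?(ltW g'0)// subr_ge0 dot_le.
  have sq : 0 <= sg * enorm e ^+ 2 - 8 * L * (enorm e * enorm d)
                 + 16 * (L ^+ 2 / sg) * enorm d ^+ 2.
    have -> : sg * enorm e ^+ 2 - 8 * L * (enorm e * enorm d)
        + 16 * (L ^+ 2 / sg) * enorm d ^+ 2 =
        sg * (enorm e - 4 * L / sg * enorm d) ^+ 2.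
      by field; rewrite gt_eqF.
    by rewrite mulr_ge0 ?sqr_ge0// ltW.
  have dd := mulr_ge0 (ltW g'0) (sqr_ge0 (enorm d)).
  have gg : gamma * gamma^-1 * dot (S x) e = dot (S x) e.
    by rewrite mulfV ?gt_eqF// mul1r.
  move: de sq dd gg; rewrite /L !enorm_sqr; move: (enorm d) (enorm e) => nd ne.
  rewrite -(mulrA 2); move: (_ / sg); rewrite invfM !dotE (dotC e d) (dotC e).
  clearbody sg.
  move: (gamma^-1) (dot (S x) e) (dot (S y) e) (dot (S y) d) (dot (S x) (S x)).
  move: (dot d e) (dot d d) (dot e e) (s x) (s y).
  by move=> *; lra.
exists r; rewrite // ler_norml; apply/andP; split; first by rewrite lerBrDl.
rewrite lerBlDl; apply: le_trans ru _.
have := quad_model_lb y x sS; have := mulr_ge0 Q0 (sqr_ge0 (enorm (y - x))).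
have -> : x - y = - (y - x) by row_ring.
rewrite (mulrDl (L / 2)); move: (_ / sg * _) => X; move: (y - x) => d.
by rewrite /L invfM !dotE; move: (gamma^-1) (dot d d) (dot (S y) d) => *; lra.
Qed.

(** Along the curve T (x + t (p - x)), flatness of [F] allows a decrease of order
    o(t) only, as [T] is Lipschitz, whereas the forward-backward envelope
    decreases linearly in [t] unless [p = x]. *)
Lemma critical_fbe_fixed (R : realType) n (gamma K D : R) (f : 'rV[R]_n -> \bar R)
    s S (F : 'rV[R]_n -> \bar R) (T : 'rV[R]_n -> 'rV[R]_n) x p :
  0 < gamma -> K < gamma^-1 -> eproper f ->
  quad_model K s S -> lipschitz_field K S ->
  (forall y, F (T y) = fbe gamma f s S y) -> lipschitz_field D T ->
  critical_point F (T x) -> prox gamma f (x - gamma *: S x) p -> p = x.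
Proof.
move=> g0 Kg fp sS Slip FT Tlip [Ffin Fdiff Fgrad] pz.
pose kap := (gamma^-1 - K) / 2; have kap0 : 0 < kap by rewrite divr_gt0// subr_gt0.
apply/eqP; rewrite -subr_eq0; apply/negPn/negP => /enorm_gt0 N0.
pose B := `|D| + 1; have B0 : 0 < B by rewrite ltr_wpDl.
(* with this tolerance [F] can vary by at most half of the decrease of the
   forward-backward envelope *)
have e0 : 0 < kap * enorm (p - x) / (2 * B) by apply: divr_gt0; apply: mulr_gt0.
have [d1 d10 fl] := grad0_littleo Fdiff Fgrad e0.
have [d2 d20 fin] := (nbhs_enormP (T x) _).1 Ffin.
have d0 : 0 < Num.min d1 d2 by rewrite lt_min d10.
have TxFin : F (T x) \is a fin_num by apply: fin; rewrite subrr enorm0.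
have [dd1 dd2] : Num.min d1 d2 <= d1 /\ Num.min d1 d2 <= d2.
  by rewrite !ge_min !lexx orbT.
move: (Num.min d1 d2) d0 dd1 dd2 => d d0 dd1 dd2.
(* [t <= 1], and [T] moves by at most [t * B * |p - x| < d] *)
pose t := d / (d + 2 * B * enorm (p - x)).
have den : 0 < d + 2 * B * enorm (p - x) by rewrite addr_gt0// !mulr_gt0.
have t0 : 0 < t by rewrite divr_gt0.
have t1 : t <= 1 by rewrite ler_pdivrMr// mul1r lerDl !mulr_ge0// ltW.
have tE : t * (d + 2 * B * enorm (p - x)) = d by rewrite divfK// gt_eqF.
have step : enorm (T (x + t *: (p - x)) - T x) <= B * (t * enorm (p - x)).
  apply: le_trans (Tlip _ _) _; rewrite addrC addKr enormZ gtr0_norm//.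
  apply: ler_wpM2r; first by rewrite mulr_ge0 ?enorm_ge0// ltW.
  by have := ler_norm D; rewrite /B; lra.
have close : enorm (T (x + t *: (p - x)) - T x) < d.
  apply: le_lt_trans step _; have := mulr_gt0 t0 d0.
  have := mulr_gt0 B0 (mulr_gt0 t0 N0); lra.
have := fbe_decrease g0 Kg fp sS Slip pz (t := t).
rewrite (ltW t0) t1 => /(_ isT); rewrite -!FT.
have := fl _ (lt_le_trans close dd1); have := fin _ (lt_le_trans close dd2).
move: TxFin; rewrite /=.
case: (F (T x)) => [r||]// _; case: (F (T _)) => [r'||]// _ /=.
rewrite ler_norml => /andP[+ _]; rewrite lee_fin -/kap.
have := ler_wpM2l (ltW e0) step.
have -> : kap * enorm (p - x) / (2 * B) * (B * (t * enorm (p - x))) =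
  kap / 2 * t * enorm (p - x) ^+ 2 by field; rewrite gt_eqF.
have : 0 < kap * t * enorm (p - x) ^+ 2 by rewrite mulr_gt0 ?exprn_gt0// mulr_gt0.
move: (_ * enorm (T _ - _)) => X; move: (enorm (p - x)) => N; clearbody kap t; lra.
Qed.

(** A function that stays within C |y - z|^2 of its value at z is differentiable
    there with zero gradient, and the Lipschitz change of variable [P] preserves
    such a bound. *)
Lemma fbe_fixed_critical (R : realType) n (gamma beta K D : R)
    (f : 'rV[R]_n -> \bar R) s S (F : 'rV[R]_n -> \bar R) (P : 'rV[R]_n -> 'rV[R]_n) z :
  0 < gamma -> beta < gamma^-1 -> eproper f -> weakly_convex beta f ->
  quad_model K s S -> lipschitz_field K S ->
  (forall y, F y = fbe gamma f s S (P y)) -> lipschitz_field D P ->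
  prox gamma f (P z - gamma *: S (P z)) (P z) -> critical_point F z.
Proof.
move=> g0 bg fp fwc sS Slip FP Plip xz.
have [a [C flat]] := fbe_flat g0 bg fp fwc sS Slip xz.
have quad y : `|fine (F y) - fine (F z) - dot 0 (y - z)| <=
    `|C| * D ^+ 2 * enorm (y - z) ^+ 2.
  rewrite !FP; have [r0 -> r0a] := flat (P z); have [r -> ra] := flat (P y).
  move: r0a; rewrite subrr enorm0 expr0n mulr0 normr_le0 subr_eq0 => /eqP->.
  rewrite dotC dot0r subr0 /=; apply: le_trans ra _.
  apply: (@le_trans _ _ (`|C| * enorm (P y - P z) ^+ 2)).
    by rewrite ler_wpM2r ?sqr_ge0// ler_norm.
  rewrite -mulrA ler_wpM2l// -exprMn ler_pXn2r ?nnegrE ?enorm_ge0//.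
  exact: le_trans (enorm_ge0 _) (Plip y z).
have [Fdiff Fgrad] := quadratic_differentiable quad.
split => //; apply/(nbhs_enormP z); exists 1 => // y _; rewrite FP.
by have [r -> _] := flat (P y).
Qed.

(** * Stationary points as fixed points of the forward-backward step *)

Lemma frechet_subgradientP (R : realType) n (psi : 'rV[R]_n -> \bar R) x v :
  frechet_subgradient psi x v <->
  forall e : R, 0 < e -> exists2 d : R, 0 < d &
    forall y, y != x -> enorm (y - x) < d ->
    ((- e)%:E <= (psi y - psi x - (dot v (y - x))%:E) / (enorm (y - x))%:E)%E.
Proof.
rewrite /frechet_subgradient limf_einfE; split=> [h e e0|h].
  have : ((- e)%:E < 0)%E by rewrite lte_fin oppr_lt0.
  move=> /lt_le_trans/(_ h)/ereal_sup_gt[_ [V xV <-] eV].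
  have [d d0 dV] := (nbhs_enormP x _).1 xV; exists d => // y yx yd.
  apply: le_trans (ltW eV) _; apply: ereal_inf_lbound; exists y => //.
  exact: dV.
apply/lee_addgt0Pr => e /h[d d0 dP]; rewrite -leeBlDr// sub0e.
apply: (@le_trans _ _ (ereal_inf
  [set ((psi y - psi x - (dot v (y - x))%:E) / (enorm (y - x))%:E)%E
    | y in [set y | y != x /\ enorm (y - x) < d]])).
  by apply: le_ereal_inf_tmp => _ [y [yx yd] <-]; exact: dP.
apply: ereal_sup_ubound; eexists => //.
apply/nbhs_enormP; exists d => // y yd yx; split => //; exact/eqP.
Qed.

(** The proximal inequality and the quadratic model of [s] give a minorant of
    f + s with a quadratic error at [x], so the difference quotients there are at
    least - C |y - x|; constant sequences then suffice. *)
Lemma prox_stationary (R : realType) n (gamma K : R) (f : 'rV[R]_n -> \bar R) s S x :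
  0 < gamma -> eproper f -> quad_model K s S ->
  prox gamma f (x - gamma *: S x) x ->
  stationary_point (fun y => f y + (s y)%:E)%E x.
Proof.
move=> g0 fp sS xz; have [a xa] := prox_fin fp xz.
split; first by rewrite /edom /= xa -EFinD ltry.
exists (fun=> x), (fun=> 0); split; [exact: cvg_cst..|move=> _].
apply/frechet_subgradientP => e e0.
pose C := `|K| / 2 + gamma^-1 / 2 + 1.
have C0 : 0 < C by rewrite ltr_wpDl// addr_ge0// divr_ge0// ltW// invr_gt0.
exists (e / C) => [|y yx]; first by rewrite divr_gt0.
have yx0 : 0 < enorm (y - x) by rewrite enorm_gt0// subr_eq0.
rewrite ltr_pdivlMr// => yd.
rewrite dotC dot0r sube0 /= xa; case E : (f y) (fp.1 y) => [b||]// _; last first.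
  rewrite [X in (X / _)%E](_ : _ = +oo%E)// gt0_mulye ?leey//.
  by rewrite inver gt_eqF// lte_fin invr_gt0.
rewrite inver gt_eqF// -!EFinD -EFinM lee_fin.
rewrite -(ler_pM2r yx0) mulfVK ?gt_eqF//.
have := prox_step_ineq g0 xz xa E; have := quad_model_lb x y sS.
rewrite subrr dot0r enorm0 expr0n mulr0.
move: yx0 yd; move: (enorm _) => N N0 yd.
have := ler_wpM2r (sqr_ge0 N) (ler_norm K).
have := ler_wpM2r (ltW N0) (ltW yd); rewrite /C invfM.
have := exprn_gt0 2 N0.
by move: (gamma^-1) (dot _ _) (s x) (s y) => *; lra.
Qed.

(** For a weakly convex function the local inequality that defines a Frechet
    subgradient propagates along segments to a global one.  If it failed at [u]
    by [eta], then the chord inequality at x + t (u - x) would contradict the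
    subgradient inequality with tolerance [eta / (4 N)] for small [t]. *)
Lemma frechet_subgradient_weakly_convex (R : realType) n (beta K : R)
    (f : 'rV[R]_n -> \bar R) s S x v u (a b : R) :
  (forall y, f y != -oo%E) -> weakly_convex beta f -> quad_model K s S ->
  frechet_subgradient (fun y => f y + (s y)%:E)%E x v ->
  f x = a%:E -> f u = b%:E ->
  a + dot (v - S x) (u - x) - beta / 2 * enorm (u - x) ^+ 2 <= b.
Proof.
move=> fN fwc sS /frechet_subgradientP fr xa ub.
have [ux|ux] := eqVneq u x.
  have -> : a = b by move: ub; rewrite ux xa => -[].
  by rewrite ux subrr enorm0 dot0r expr0n mulr0 subr0 addr0.
have N0 : 0 < enorm (u - x) by rewrite enorm_gt0// subr_eq0.
set N := enorm (u - x) in N0 *.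
rewrite leNgt; apply/negP; rewrite -subr_gt0.
set eta := _ - b => eta0.
have [d d0 dP] := fr (eta / (4 * N)) ltac:(by rewrite divr_gt0// mulr_gt0).
(* the three summands give in turn [t <= 1], [t * N < d] and a quadratic error
   of at most [eta] *)
pose t := (1 + N / d + `|K - beta| * N ^+ 2 / eta)^-1.
have h1 : 0 <= N / d by rewrite divr_ge0// ltW.
have h2 : 0 <= `|K - beta| * N ^+ 2 / eta by rewrite divr_ge0 ?mulr_ge0 ?sqr_ge0// ltW.
have D0 : 0 < 1 + N / d + `|K - beta| * N ^+ 2 / eta by lra.
have t0 : 0 < t by rewrite invr_gt0.
have t1 : t <= 1 by rewrite /t invf_le1//; lra.
have tD : t * (1 + N / d + `|K - beta| * N ^+ 2 / eta) = 1 by rewrite mulVf// gt_eqF.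
have tN : t * N < d.
  rewrite -(ltr_pM2r (_ : 0 < d^-1)) ?invr_gt0// mulfV ?gt_eqF// -tD -[ltLHS]mulrA.
  by rewrite ltr_pM2l//; lra.
have tK : (K - beta) * t * N ^+ 2 <= eta.
  apply: (@le_trans _ _ (`|K - beta| * (t * N ^+ 2))).
    by rewrite -mulrA ler_wpM2r ?ler_norm// mulr_ge0 ?sqr_ge0// ltW.
  have -> : `|K - beta| * (t * N ^+ 2) = t * (`|K - beta| * N ^+ 2 / eta) * eta.
    by field; rewrite gt_eqF.
  rewrite -[leRHS]mul1r ler_pM2r// -tD ler_pM2l//; lra.
pose z := t *: u + (1 - t) *: x.
have zx : z - x = t *: (u - x) by rewrite /z; row_ring.
have zN : enorm (z - x) = t * N by rewrite zx enormZ gtr0_norm.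
have := dP z; rewrite zN => /(_ _ tN) dz.
have zx0 : z != x.
  by rewrite -subr_eq0 zx scaler_eq0 negb_or gt_eqF// subr_eq0 ux.
move: (dz zx0); have := weakly_convex_le (t := t) fwc ub xa.
rewrite (ltW t0) t1 => /(_ isT); rewrite -/z -/N.
case E : (f z) (fN z) => [c||]// _; rewrite lee_fin xa => cle.
have tN0 : 0 < t * N by rewrite mulr_gt0.
rewrite inver gt_eqF// -!EFinD -EFinM lee_fin -(ler_pM2r tN0) mulfVK ?gt_eqF//.
have -> : - (eta / (4 * N)) * (t * N) = - (eta / 4 * t) by field; rewrite gt_eqF.
have := quad_model_ub x z sS; rewrite zN zx.
have : eta = a + dot (v - S x) (u - x) - beta / 2 * N ^+ 2 - b by [].
rewrite dotDl dotNl !dotZr.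
move: (dot _ _) (dot _ _) (s x) (s z) => vx Sx sx sz etaE szle.
have := ler_wpM2l (ltW t0) tK.
have := mulr_gt0 eta0 t0; have := congr1 ( *%R t) etaE.
clearbody eta N; move: szle cle; clear; lra.
Qed.

(** The global minorants of [f] at the approximating points converge to the
    minorant f u >= f x - <S x, u - x> - beta / 2 |u - x|^2 ; as
    [beta < gamma^-1], this says that [x] solves the proximal problem. *)
Lemma stationary_prox (R : realType) n (gamma beta K : R) (f : 'rV[R]_n -> \bar R)
    s S x :
  0 < gamma -> beta < gamma^-1 -> eproper f -> weakly_convex beta f ->
  quad_model K s S -> lipschitz_field K S ->
  stationary_point (fun y => f y + (s y)%:E)%E x -> prox gamma f (x - gamma *: S x) x.
Proof.
move=> g0 bg fp fwc sS Slip [xdom [us [vs [ux psi_cvg v0 fr]]]].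
have [a xa] : exists a, f x = a%:E.
  move: xdom; rewrite /edom /=; case: (f x) (fp.1 x) => [a||]//= _ _; by exists a.
move: psi_cvg; rewrite xa -EFinD => /fine_cvgP[psi_fin psi_cvg].
have scont : (s (us t) : R^o) @[t --> \oo] --> s x.
  apply: cvg_comp ux _.
  exact: (differentiable_continuous (quadratic_differentiable (sS x)).1).
have Scont := cvg_lipschitz_field Slip ux.
have ineq u b : f u = b%:E ->
    a + dot (0 - S x) (u - x) - beta / 2 * dot (u - x) (u - x) <= b.
  move=> ub; have uux : (u - us t) @[t --> \oo] --> u - x.
    by apply: cvgB => //; exact: cvg_cst.
  have c1 : (vs t - S (us t)) @[t --> \oo] --> 0 - S x by apply: cvgB.
  have c3 : (fine (f (us t) + (s (us t))%:E)%E - s (us t)) @[t --> \oo] --> a.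
    by rewrite -[a](addrK (s x)); apply: cvgB.
  have c4 : (fine (f (us t) + (s (us t))%:E)%E - s (us t)
       + dot (vs t - S (us t)) (u - us t)
       - beta / 2 * dot (u - us t) (u - us t)) @[t --> \oo] -->
       a + dot (0 - S x) (u - x) - beta / 2 * dot (u - x) (u - x).
    apply: cvgB; first by apply: cvgD => //; exact: cvg_dot.
    by apply: cvgMr; exact: cvg_dot.
  apply: (ler_cvg_to c4 (cvg_cst b)).
  apply: filterS psi_fin => t /= ft.
  have [c Ec] : exists c, f (us t) = c%:E.
    by case: (f (us t)) (fp.1 (us t)) ft => [c||]// _ _; exists c.
  have := frechet_subgradient_weakly_convex fp.1 fwc sS (fr t) Ec ub.
  by rewrite Ec /= addrK enorm_sqr.
move=> u /=; rewrite xa; case E : (f u) (fp.1 u) => [b||]// _; last by rewrite leey.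
rewrite -!EFinD lee_fin; have := ineq u b E.
have -> : x - (x - gamma *: S x) = gamma *: S x by row_ring.
have -> : u - (x - gamma *: S x) = (u - x) + gamma *: S x by row_ring.
have : 0 <= (gamma^-1 - beta) * dot (u - x) (u - x).
  by rewrite mulr_ge0 ?dotuu_ge0// subr_ge0 ltW.
move: (u - x) (S x) => d w; rewrite sub0r invfM !dotE (dotC d w).
have e1 : gamma * gamma^-1 * dot w d = dot w d by rewrite mulfV ?gt_eqF// mul1r.
by move: (gamma^-1) (dot w d) (dot d d) (dot w w) e1 => *; lra.
Qed.

(** * The splitting envelope as a forward-backward envelope *)

Lemma lt_inve (R : realType) (gamma K : R) : 0 < gamma ->
  (gamma%:E < (K%:E)^-1)%E = (0 <= K) && (K < gamma^-1).
Proof.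
move=> g0; rewrite inver; case: (ltgtP 0 K) => [K0|K0|<-] /=.
- by rewrite lte_fin -(ltf_pV2 _ _)// ?posrE ?invr_gt0// invrK.
- rewrite lte_fin; apply/negbTE; rewrite -leNgt.
  by apply: le_trans (ltW g0); rewrite invr_le0 ltW.
- by rewrite ltry invr_gt0.
Qed.

(** A negative Lipschitz constant is possible only on the zero-dimensional space,
    where the operator norm of [L] vanishes, so that replacing the constant by 0
    keeps the product with the squared norm. *)
Lemma lipschitz_differentiable_nonneg (R : realType) n m (M : R) (h : 'rV[R]_m -> R)
    (L : {linear 'rV[R]_n -> 'rV[R]_m}) :
  lipschitz_differentiable M h -> exists M',
    [/\ 0 <= M', lipschitz_differentiable M' h & M' * opnorm L ^+ 2 = M * opnorm L ^+ 2].
Proof.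
move=> [dh lh]; have [M0|M0] := leP 0 M; first by exists M.
have zero (v : 'rV[R]_m) : v = 0.
  apply: enorm_eq0; have := le_trans (enorm_ge0 _) (lh v 0).
  by rewrite subr0 nmulr_rge0.
exists 0; split => //.
  by split => // x y; rewrite mul0r (zero (_ - _)) enorm0.
suff -> : opnorm L = 0 by rewrite expr0n !mulr0.
apply/eqP; rewrite eq_le opnorm_ge0 andbT; apply: ge_sup.
  exact: (opnorm_has_sup L).1.
by move=> _ [u _ <-]; rewrite (zero (L u)) enorm0.
Qed.

Definition smooth_part (R : realType) n m (g : 'rV[R]_n -> R) (h : 'rV[R]_m -> R)
  (L : {linear 'rV[R]_n -> 'rV[R]_m}) x := g x + h (L x).

Definition smooth_grad (R : realType) n m (g : 'rV[R]_n -> R) (h : 'rV[R]_m -> R)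
  (L : {linear 'rV[R]_n -> 'rV[R]_m}) x := grad g x + adjoint L (grad h (L x)).

Lemma smooth_part_quad (R : realType) n m (g : 'rV[R]_n -> R) (h : 'rV[R]_m -> R)
    (L : {linear 'rV[R]_n -> 'rV[R]_m}) (Lg Lh : R) :
  0 <= Lh -> lipschitz_differentiable Lg g -> lipschitz_differentiable Lh h ->
  quad_model (Lg + Lh * opnorm L ^+ 2) (smooth_part g h L) (smooth_grad g h L).
Proof.
move=> Lh0 gL hL x y; rewrite /smooth_part /smooth_grad dotDl dot_adjoint (linearB L).
have := descent gL x y; have := descent hL (L x) (L y).
have : Lh * enorm (L y - L x) ^+ 2 <= Lh * (opnorm L ^+ 2 * enorm (y - x) ^+ 2).
  rewrite ler_wpM2l// -exprMn ler_pXn2r ?nnegrE ?mulr_ge0 ?enorm_ge0 ?opnorm_ge0//.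
  by rewrite -(linearB L) enorm_le_opnorm.
rewrite !ler_norml; move: (enorm _ ^+ 2) (enorm _ ^+ 2) (opnorm L ^+ 2) => a b c.
move: (dot _ _) (dot _ _) (g x) (g y) (h (L x)) (h (L y)) => d e gx gy hx hy.
by move=> ab /andP[h1 h2] /andP[h3 h4]; apply/andP; split; lra.
Qed.

Lemma smooth_grad_lipschitz (R : realType) n m (g : 'rV[R]_n -> R) (h : 'rV[R]_m -> R)
    (L : {linear 'rV[R]_n -> 'rV[R]_m}) (Lg Lh : R) :
  0 <= Lh -> lipschitz_differentiable Lg g -> lipschitz_differentiable Lh h ->
  lipschitz_field (Lg + Lh * opnorm L ^+ 2) (smooth_grad g h L).
Proof.
move=> Lh0 gL hL x y.
have -> : smooth_grad g h L x - smooth_grad g h L y =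
    (grad g x - grad g y) + adjoint L (grad h (L x) - grad h (L y)).
  by rewrite adjointB /smooth_grad opprD addrACA.
apply: le_trans (enormD _ _) _; rewrite mulrDl lerD ?gL.2//.
apply: le_trans (adjoint_le_opnorm _ _) _.
rewrite expr2 mulrCA -mulrA ler_wpM2l ?opnorm_ge0//; apply: le_trans (hL.2 _ _) _.
by rewrite -mulrA ler_wpM2l// -(linearB L) enorm_le_opnorm.
Qed.

(** The gradient of the Moreau envelope of [g] is [grad g x] with
    [z = x + gamma grad g x], so the inner argument z - 2 gamma grad g x - gamma q
    is the forward step x - gamma (grad g x + q); expanding the square in the
    Moreau envelope of [f] there yields the linear term in [u - x] and cancels
    the correction terms. *)
Lemma envelope_fbe (R : realType) n m (gamma Lg : R) (f : 'rV[R]_n -> \bar R)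
    (g : 'rV[R]_n -> R) (h : 'rV[R]_m -> R) (L : {linear 'rV[R]_n -> 'rV[R]_m}) z :
  0 < gamma -> Lg < gamma^-1 -> lipschitz_differentiable Lg g ->
  envelope gamma f g h L z =
    fbe gamma f (smooth_part g h L) (smooth_grad g h L) (prox_pt gamma (EFin \o g) z).
Proof.
move=> g0 Lgg gL; have gG := descent gL.
have := quad_model_prox_pt g0 Lgg gG z (prox_pt gamma (EFin \o g) z).
rewrite /envelope /=; move: (prox_pt _ _ _) => x [/(_ erefl) xz _].
have xprox : prox gamma (EFin \o g) z x by apply/(quad_model_proxP _ _ g0 Lgg gG).
have gp : eproper (EFin \o g) by split=> //; exists 0; rewrite ltry.
have mE : moreau gamma (EFin \o g) z = (g x + (2 * gamma)^-1 * enorm (z - x) ^+ 2)%:E.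
  apply/eqP; rewrite eq_le; apply/andP; split.
    by apply: ereal_inf_lbound; exists x.
  apply: le_ereal_inf_tmp => _ [u _ <-].
  by have := xprox u; rewrite (enorm_distC x) (enorm_distC u).
have [C mC] := moreau_quadratic g0 Lgg gp (quad_model_weakly_convex gG) xprox.
have gE : grad (fine \o moreau gamma (EFin \o g)) z = grad g x.
  rewrite (quadratic_differentiable mC).2 -xz [x + _]addrC addrK scalerA mulVf ?gt_eqF//.
  by rewrite scale1r.
rewrite gE mE -xz [x + _ - x]addrC addKr.
set q := adjoint L _; set G := grad g x.
rewrite -!EFinD addeC.
rewrite [moreau gamma f _]/(infsum f _) infsum_addr /fbe; congr infsum.
apply/funext => u.
have -> : x + gamma *: G - (2 * gamma) *: G - gamma *: q - u =
    - (u - x) - gamma *: (G + q) by row_ring.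
rewrite /smooth_part /smooth_grad -/G -/q; move: (u - x) (h _) (g x) => d hx gx.
clearbody G q; rewrite invfM !dotE (dotC G q) !(dotC d).
(* [gamma^-1] is about to become a free variable; these are the cancellations
   with [gamma] that the final linear arithmetic relies on *)
have gg : gamma * gamma^-1 = 1 by rewrite mulfV ?gt_eqF.
have e1 : gamma * gamma^-1 * dot G d = dot G d by rewrite gg mul1r.
have e2 : gamma * gamma^-1 * dot q d = dot q d by rewrite gg mul1r.
have e3 X : gamma * gamma^-1 * (gamma * X) = gamma * X by rewrite gg mul1r.
have e4 := e3 (dot q q); have e5 := e3 (dot q G); have {e3} e6 := e3 (dot G G).
move: e1 e2 e4 e5 e6.
move: (gamma^-1) (dot d d) (dot G d) (dot q d) (dot q q) (dot G G) (dot q G) => *; lra.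
Qed.

Theorem theorem7 (R : realType) (n m : nat)
    (f : 'rV[R]_n -> \bar R) (g : 'rV[R]_n -> R) (h : 'rV[R]_m -> R)
    (L : {linear 'rV[R]_n -> 'rV[R]_m}) (Lg Lh betaf gamma : R)
    (hg : lipschitz_differentiable Lg g)
    (hh : lipschitz_differentiable Lh h)
    (hf_proper : eproper f)
    (hf_lsc : lower_semicontinuous f)
    (hgamma0 : 0 < gamma)
    (hgamma : (gamma%:E < ((Lg + Lh * opnorm L ^+ 2)%:E)^-1)%E)
    (hf_below : forall gamma' : R, 0 < gamma' ->
       (gamma'%:E < ((Lg + Lh * opnorm L ^+ 2)%:E)^-1)%E ->
       ebounded_below
         (fun x => (f x + ((2 * gamma')^-1 * enorm x ^+ 2)%:E)%E))
    (hf_wconvex : weakly_convex betaf f)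
    (hgamma_betaf : (gamma%:E < (betaf%:E)^-1)%E)
    (hg2 : twice_continuously_differentiable g)
    (hh2 : twice_continuously_differentiable h)
    (z : 'rV[R]_n) :
  critical_point (envelope gamma f g h L) z <->
  stationary_point (objective f g h L) (prox_pt gamma (EFin \o g) z).
Proof.
have [M [M0 hM eM]] := lipschitz_differentiable_nonneg L hh.
rewrite -eM in hgamma hf_below.
move: hgamma_betaf; rewrite lt_inve// => /andP[_ bg].
move: (hgamma); rewrite lt_inve// => /andP[K0 Kg].
have sS := smooth_part_quad L M0 hg hM.
have Slip := smooth_grad_lipschitz L M0 hg hM.
have Lgg : Lg < gamma^-1.
  by apply: le_lt_trans Kg; rewrite lerDl mulr_ge0 ?sqr_ge0.
have envE y := envelope_fbe f h L y hgamma0 Lgg hg.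
have ptP := quad_model_prox_pt hgamma0 Lgg (descent hg).
move: hf_below {hgamma} K0 Kg sS Slip; set K := Lg + _ => below K0 Kg sS Slip.
have -> : objective f g h L = (fun y => f y + (smooth_part g h L y)%:E)%E.
  by apply/funext => y; rewrite /objective -addeA -EFinD.
split=> [crit|xstat].
  (* [f] has a quadratic minorant for every constant above [K]; one strictly
     below [gamma^-1] makes the forward-backward problem bounded below *)
  pose mu := (K + gamma^-1) / 2.
  have mu0 : 0 < mu by rewrite divr_gt0// ltr_wpDl// invr_gt0.
  have Kmu : K < mu by rewrite /mu; lra.
  have mug : mu < gamma^-1 by rewrite /mu; lra.
  have [c cf] : exists c : R, forall x,
      (c%:E <= f x + (mu / 2 * enorm x ^+ 2)%:E)%E.
    have [||c cf] := below mu^-1; first by rewrite invr_gt0.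
      by rewrite lt_inve ?invr_gt0// invrK K0.
    by exists c => u; have := cf u; rewrite invfM invrK [2^-1 * _]mulrC.
  have Tz := (ptP z _).1 erefl.
  move: (prox_pt _ _ z) Tz => x Tz.
  apply: (prox_stationary hgamma0 hf_proper sS).
  have [p pz] := prox_exists (x - gamma *: smooth_grad g h L x) hgamma0 bg mug
    hf_proper hf_lsc hf_wconvex cf.
  rewrite -Tz in crit.
  have Tlip := forward_step_lipschitz hgamma0 hg.2.
  have FT y : envelope gamma f g h L (y + gamma *: grad g y) =
      fbe gamma f (smooth_part g h L) (smooth_grad g h L) y.
    by rewrite envE (_ : prox_pt _ _ _ = y)//; apply/ptP.
  have px := critical_fbe_fixed hgamma0 Kg hf_proper sS Slip FT Tlip crit pz.
  by rewrite px in pz.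
apply: (fbe_fixed_critical hgamma0 bg hf_proper hf_wconvex sS Slip envE).
  by apply: (forward_step_inv_lipschitz hgamma0 Lgg hg.2) => y; apply/ptP.
exact (stationary_prox hgamma0 bg hf_proper hf_wconvex sS Slip xstat).
Qed.
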